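(* Let $V$ be a smooth scheme over a field $k$, and let $\mathcal{G}$ and $\mathcal{G}'$ be two Rees algebras over $V$ with the same integral closure (i.e. $\mathcal{G}$ and $\mathcal{G}'$ are integrally equivalent). Then for each $x\in \mathrm{Sing}(\mathcal{G})=\mathrm{Sing}(\mathcal{G}')$ one has $\tau_{\mathcal{G},x}=\tau_{\mathcal{G}',x}$.
   Context: A Rees algebra over a smooth scheme $V$ is a graded subalgebra $\mathcal{G}=\bigoplus_{n\ge 0} I_nW^n$ of $\mathcal{O}_V[W]$ ($W$ a dummy variable), where the $I_n$ are sheaves of ideals with $I_0=\mathcal{O}_V$ and $I_sI_t\subset I_{s+t}$, which is locally a finitely generated $\mathcal{O}_V$-algebra. Locally $\mathcal{G}=\mathcal{O}_V[f_1W^{n_1},\dots,f_sW^{n_s}]$ with $n_i\ge 1$. Two Rees algebras over $V$ are integrally equivalent, written $\mathcal{G}\sim\mathcal{G}'$, if they have the same integral closure (in $\mathcal{O}_V[W]$). The singular locus is $\mathrm{Sing}(\mathcal{G})=\{x\in V : \nu_x(I_n)\ge n \text{ for all } n\ge 1\}$, where $\nu_x(I_n)$ is the order of $I_n$ at the regular local ring $\mathcal{O}_{V,x}$. Integrally equivalent Rees algebras have the same singular locus. For $x\in\mathrm{Sing}(\mathcal{G})$, with maximal ideal $\mathfrak{M}_x\subset\mathcal{O}_{V,x}$ and residue field $k(x)$, let $\mathrm{In}_n(I_n)$ be the image of $I_n$ in $\mathfrak{M}_x^n/\mathfrak{M}_x^{n+1}$, and let $\mathbb{I}_{\mathcal{G},x}$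 be the homogeneous ideal of $gr_{\mathfrak{M}_x}(\mathcal{O}_{V,x})$ generated by all $\mathrm{In}_n(I_n)$, $n\ge 1$. The tangent space is $\mathbb{T}_{V,x}=\mathrm{Spec}(gr_{\mathfrak{M}_x}(\mathcal{O}_{V,x}))$, and the cone $\mathcal{C}_{\mathcal{G}}\subset\mathbb{T}_{V,x}$ is the zero set of $\mathbb{I}_{\mathcal{G},x}$ (as a closed subset, equivalently as a reduced closed subscheme). The linear space of vertices $\mathcal{L}_{\mathcal{G},x}$ is the largest $k(x)$-linear subspace such that translation by each $v\in\mathcal{L}_{\mathcal{G},x}$ maps $\mathcal{C}_{\mathcal{G}}$ onto itself (it is automatically contained in $\mathcal{C}_{\mathcal{G}}$). Hironaka's $\tau$-invariant $\tau_{\mathcal{G},x}$ is the codimension of $\mathcal{L}_{\mathcal{G},x}$ in $\mathbb{T}_{V,x}$. *)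

(* Defs.v *)
From HB Require Import structures.
From mathcomp Require Import all_boot all_order all_algebra.
From mathcomp Require Import ring_quotient generic_quotient.
From mathcomp Require Import boolp classical_sets topology.

Set Implicit Arguments.
Unset Strict Implicit.
Unset Printing Implicit Defensive.

Import GRing.Theory.
Local Open Scope classical_set_scope.
Local Open Scope ring_scope.
Local Open Scope quotient_scope.

Section Ideals.
Variable A : comPzRingType.

Definition is_ideal (J : set A) : Prop :=
  [/\ J 0, forall a b, J a -> J b -> J (a + b) & forall a b, J b -> J (a * b)].

Definition prime_ideal (P : set A) : Prop :=
  [/\ is_ideal P, ~ P 1 & forall a b, P (a * b) -> P a \/ P b].

Definition ideal_gen (S : set A) : set A :=
  [set a | forall J, is_ideal J -> S `<=` J -> J a].

Fixpoint ideal_pow (J : set A) (n : nat) : set A :=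
  if n is n'.+1 then
    ideal_gen [set c | exists a b, [/\ J a, ideal_pow J n' b & c = a * b]]
  else setT.

Lemma ideal_gen_ideal S : is_ideal (ideal_gen S).
Proof.
split=> [J [J0 _ _] _|a b Ha Hb J iJ SJ|a b Hb J iJ SJ] //.
- by have [_ JD _] := iJ; apply: JD; [apply: Ha | apply: Hb].
- by have [_ _ JM] := iJ; apply: JM; apply: Hb.
Qed.

Lemma sub_ideal_gen S : S `<=` ideal_gen S.
Proof. by move=> a Sa J _; apply. Qed.

Lemma ideal_pow_ideal J n : is_ideal (ideal_pow J n).
Proof. by case: n => [//|n]; apply: ideal_gen_ideal. Qed.

Lemma idealD J a b : is_ideal J -> J a -> J b -> J (a + b).
Proof. by case=> _ + _; apply. Qed.
Lemma idealM J a b : is_ideal J -> J b -> J (a * b).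
Proof. by case=> _ _; apply. Qed.
Lemma idealN J a : is_ideal J -> J a -> J (- a).
Proof. by move=> iJ Ja; rewrite -mulN1r; apply: idealM. Qed.
Lemma ideal0 J : is_ideal J -> J 0. Proof. by case. Qed.
Lemma ideal_sum J (I : Type) (r : seq I) (P : pred I) (F : I -> A) :
  is_ideal J -> (forall i, P i -> J (F i)) -> J (\sum_(i <- r | P i) F i).
Proof.
move=> iJ H; elim/big_ind: _ => //; first exact: ideal0.
by move=> x y; apply: idealD.
Qed.

Lemma ideal_pow_mul J i j a b :
  ideal_pow J i a -> ideal_pow J j b -> ideal_pow J (i + j) (a * b).
Proof.
move=> Ha Hb; elim: i a Ha => [|i IH] a Ha.
  by rewrite add0n; apply: idealM => //; apply: ideal_pow_ideal.
suff: [set c | ideal_pow J (i.+1 + j) (c * b)] a by [].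
apply: Ha => /=; last first.
  move=> _ [x [y [Jx Hy ->]]] /=; rewrite -mulrA; apply: sub_ideal_gen.
  by exists x, (y * b); split => //; apply: IH.
have iJ : is_ideal (ideal_pow J (i.+1 + j)) by apply: ideal_pow_ideal.
split=> [|x y|x y] /=; first by rewrite mul0r; apply: ideal0.
- by rewrite mulrDl; apply: idealD.
- by rewrite -mulrA; apply: idealM.
Qed.

Lemma ideal_pow1 J : is_ideal J -> ideal_pow J 1 = J.
Proof.
move=> iJ; apply/seteqP; split=> a Ja.
  by apply: Ja => // _ [x [y [Jx _ ->]]]; rewrite mulrC; apply: idealM.
by apply: sub_ideal_gen; exists a, 1; rewrite mulr1.
Qed.

End Ideals.

Definition is_localization_away (A B : comPzRingType) (f : A) (h : A -> B) :=
  [/\ exists g, h f * g = 1,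
      forall b, exists n a, b * h f ^+ n = h a
    & forall a, h a = 0 -> exists n, f ^+ n * a = 0].

Record opens (X : topologicalType) := Opens {
  oset :> set X;
  oset_open : open oset }.

Record ringedSpace := RingedSpace {
  pts :> topologicalType;
  sec : opens pts -> comPzRingType;
  res : forall U W : opens pts, W `<=` U -> {rmorphism sec U -> sec W};
  res_id : forall (U : opens pts) (h : U `<=` U) s, res h s = s;
  res_comp : forall (U W Z : opens pts)
      (hWU : W `<=` U) (hZW : Z `<=` W) (hZU : Z `<=` U) s,
    res hZW (res hWU s) = res hZU s;
  sec_separated : forall (U : opens pts) (I : Type) (C : I -> opens pts)
      (hC : forall i, C i `<=` U), U `<=` \bigcup_i C i ->
    forall s t : sec U, (forall i, res (hC i) s = res (hC i) t) -> s = t;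
  sec_glue : forall (U : opens pts) (I : Type) (C : I -> opens pts)
      (hC : forall i, C i `<=` U), U `<=` \bigcup_i C i ->
    forall s : (forall i, sec (C i)),
      (forall i j (W : opens pts) (hi : W `<=` C i) (hj : W `<=` C j),
         res hi (s i) = res hj (s j)) ->
    exists t : sec U, forall i, res (hC i) t = s i }.

Arguments res {r U W} h.
Arguments sec : clear implicits.

(* (U, O_U) is isomorphic to Spec A for some A: phi is the homeomorphism      *)
(* from U to the prime spectrum, and a sheaf on Spec A is the structure sheaf *)
(* as soon as A -> O(D(f)) is the localization A -> A_f for all f.            *)
Definition affine_open (V : ringedSpace) (U : opens V) : Prop :=
  exists (A : comPzRingType) (alpha : {rmorphism A -> sec V U})
         (phi : V -> set A),
  [/\ forall x, oset U x -> prime_ideal (phi x),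
      forall x y, oset U x -> oset U y -> phi x = phi y -> x = y,
      forall P, prime_ideal P -> exists2 x, oset U x & phi x = P,
      forall W : set V, W `<=` U ->
        (open W <-> forall x, W x ->
           exists2 f, ~ phi x f & forall y, oset U y -> ~ phi y f -> W y)
    & forall (f : A) (W : opens V) (hWU : W `<=` U),
        (forall y, oset W y <-> oset U y /\ ~ phi y f) ->
        is_localization_away f (fun a => res hWU (alpha a))].

Record scheme := Scheme {
  space :> ringedSpace;
  scheme_charts : forall x : space,
    exists2 U : opens space, oset U x & affine_open U }.

Definition topen (X : topologicalType) : opens X := Opens (@openT X).

Lemma opens_top (X : topologicalType) (U : opens X) : U `<=` topen X.
Proof. by []. Qed.

Section Smooth.
Variable k : fieldType.

Definition finite_type_alg (A : comPzRingType) (i : {rmorphism k -> A}) : Prop :=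
  exists (n : nat) (g : 'I_n -> A), forall S : set A,
    (forall c, S (i c)) -> (forall j, S (g j)) ->
    (forall a b, S a -> S b -> S (a + b)) ->
    (forall a b, S a -> S b -> S (a * b)) -> forall a, S a.

Definition formally_smooth_alg (A : comPzRingType) (i : {rmorphism k -> A}) :=
  forall (B C : comPzRingType) (j : {rmorphism k -> B})
         (q : {rmorphism B -> C}) (u : {rmorphism A -> C}),
    (forall c, exists b, q b = c) ->
    (forall a b, q a = 0 -> q b = 0 -> a * b = 0) ->
    (forall c, u (i c) = q (j c)) ->
    exists w : {rmorphism A -> B},
      (forall a, q (w a) = u a) /\ (forall c, w (i c) = j c).

(* Over a field, finite type is the same as finite presentation. *)
Definition smooth_alg (A : comPzRingType) (i : {rmorphism k -> A}) : Prop :=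
  finite_type_alg i /\ formally_smooth_alg i.

(* A morphism V -> Spec k is the same as a ring morphism k -> O(V). *)
Definition smooth (V : scheme) (str : {rmorphism k -> sec V (topen V)}) : Prop :=
  forall x : V, exists U : opens V,
    [/\ oset U x, affine_open U & smooth_alg (res (@opens_top V U) \o str)].

End Smooth.

Section Stalk.
Variables (V : ringedSpace) (x : V).

Record presec := Presec {
  ps_dom : opens V;
  ps_in : oset ps_dom x;
  ps_sec : sec V ps_dom }.

HB.instance Definition _ := gen_eqMixin presec.
HB.instance Definition _ := gen_choiceMixin presec.

Definition presec_eq (a b : presec) : bool :=
  `[< exists (W : opens V) (ha : W `<=` ps_dom a) (hb : W `<=` ps_dom b),
        oset W x /\ res ha (ps_sec a) = res hb (ps_sec b) >].

Lemma opensI_open (U W : opens V) : open (oset U `&` oset W).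
Proof. exact: openI (oset_open U) (oset_open W). Qed.
Definition opensI (U W : opens V) : opens V := Opens (opensI_open U W).
Lemma opensIl (U W : opens V) : opensI U W `<=` U. Proof. by move=> ? []. Qed.
Lemma opensIr (U W : opens V) : opensI U W `<=` W. Proof. by move=> ? []. Qed.

Lemma presec_eq_equiv : equiv_class_of presec_eq.
Proof.
split=> [a|a b|b a c].
- by apply/asboolP; exists (ps_dom a), (fun _ h => h), (fun _ h => h); split=> //; case: a.
- by apply/asboolP/asboolP => -[W [ha [hb [Wx e]]]]; exists W, hb, ha.
- move=> /asboolP[W [ha [hb [Wx e]]]] /asboolP[Z [hb' [hc [Zx e']]]].
  have hW : opensI W Z `<=` W by move=> ? [].
  have hZ : opensI W Z `<=` Z by move=> ? [].
  apply/asboolP; exists (opensI W Z), (subset_trans hW ha), (subset_trans hZ hc).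
  split=> //; rewrite -(res_comp ha hW) e -(res_comp hc hZ) -e'.
  by rewrite !(res_comp _ _ (subset_trans hW hb)).
Qed.

Canonical presec_equivRel := EquivRelPack presec_eq_equiv.
Canonical presec_encModRel := defaultEncModRel presec_eq.

Definition stalk := {eq_quot presec_eq}.
HB.instance Definition _ := Choice.on stalk.

Definition germ (U : opens V) (hU : oset U x) (s : sec V U) : stalk :=
  \pi_stalk (Presec hU s).

Lemma germ_eq U (hU : oset U x) (s : sec V U) W (hW : oset W x) (t : sec V W) :
  germ hU s = germ hW t <->
  exists (Z : opens V) (hZU : Z `<=` U) (hZW : Z `<=` W),
    oset Z x /\ res hZU s = res hZW t.
Proof.
split=> [/eqmodP/= /asboolP //|H]; apply/eqmodP => /=; exact/asboolP.
Qed.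

Lemma germ_res U (hU : oset U x) (s : sec V U) W (hW : oset W x) (h : W `<=` U) :
  germ hW (res h s) = germ hU s.
Proof.
apply/germ_eq; exists W, (fun _ w => w), h; split=> //.
by rewrite (res_comp _ _ h).
Qed.

Lemma germP (a : stalk) : exists U (hU : oset U x) s, a = germ hU s.
Proof.
by elim/quotW: a => -[U hU s]; exists U, hU, s.
Qed.

Lemma germP2 (a b : stalk) : exists U (hU : oset U x) s t,
  a = germ hU s /\ b = germ hU t.
Proof.
have [U [hU [s ->]]] := germP a; have [W [hW [t ->]]] := germP b.
have h1 : opensI U W `<=` U by move=> ? [].
have h2 : opensI U W `<=` W by move=> ? [].
have h : oset (opensI U W) x by [].
by exists (opensI U W), h, (res h1 s), (res h2 t); rewrite !germ_res.
Qed.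

Lemma germP3 (a b c : stalk) : exists U (hU : oset U x) s t r,
  [/\ a = germ hU s, b = germ hU t & c = germ hU r].
Proof.
have [U [hU [s [t [-> ->]]]]] := germP2 a b; have [W [hW [r ->]]] := germP c.
have h1 : opensI U W `<=` U by move=> ? [].
have h2 : opensI U W `<=` W by move=> ? [].
have h : oset (opensI U W) x by [].
by exists (opensI U W), h, (res h1 s), (res h1 t), (res h2 r); rewrite !germ_res.
Qed.

Definition stalk0 : stalk := germ (U := topen V) I 0.
Definition stalk1 : stalk := germ (U := topen V) I 1.
Definition stalk_opp (a : stalk) : stalk := germ (ps_in (repr a)) (- ps_sec (repr a)).

Definition stalk_bin (op : forall R : comPzRingType, R -> R -> R) (a b : stalk) :
    stalk :=
  let p := repr a in let q := repr b in
  germ (U := opensI (ps_dom p) (ps_dom q)) (conj (ps_in p) (ps_in q))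
    (op _ (res (@opensIl _ _) (ps_sec p)) (res (@opensIr _ _) (ps_sec q))).
Definition stalk_add := stalk_bin (fun R => +%R).
Definition stalk_mul := stalk_bin (fun R => *%R).

Lemma germ_repr U (hU : oset U x) s : exists (Z : opens V)
    (hZ : Z `<=` ps_dom (repr (germ hU s))) (hZU : Z `<=` U),
  oset Z x /\ res hZ (ps_sec (repr (germ hU s))) = res hZU s.
Proof.
set p := repr _; apply/(germ_eq (ps_in p)).
by rewrite -[RHS]reprK -/p /germ; case: (p).
Qed.

Lemma germ_bin op U (hU : oset U x) s t :
  (forall (R S : comPzRingType) (f : {rmorphism R -> S}),
     {morph f : a b / op R a b >-> op S a b}) ->
  stalk_bin op (germ hU s) (germ hU t) = germ hU (op _ s t).
Proof.
move=> opM; apply/germ_eq => /=.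
have [Z [hZ [hZU [Zx e]]]] := germ_repr hU s.
have [W [hW [hWU [Wx e']]]] := germ_repr hU t.
have h1 : opensI Z W `<=` Z by move=> ? [].
have h2 : opensI Z W `<=` W by move=> ? [].
have h : opensI Z W `<=` opensI (ps_dom (repr (germ hU s))) (ps_dom (repr (germ hU t))).
  by move=> y [/hZ ? /hW ?].
exists (opensI Z W), h, (subset_trans h1 hZU); split=> //; rewrite !opM.
rewrite (res_comp _ _ (subset_trans h1 hZ)) (res_comp _ _ (subset_trans h2 hW)).
rewrite -(res_comp hZ h1) e -(res_comp hW h2) e'.
by rewrite (res_comp _ _ (subset_trans h1 hZU)) (res_comp _ _ (subset_trans h1 hZU)).
Qed.

Lemma germ_add U (hU : oset U x) s t :
  stalk_add (germ hU s) (germ hU t) = germ hU (s + t).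
Proof. by apply: germ_bin => R S f a b; rewrite /= rmorphD. Qed.

Lemma germ_mul U (hU : oset U x) s t :
  stalk_mul (germ hU s) (germ hU t) = germ hU (s * t).
Proof. by apply: germ_bin => R S f a b; rewrite /= rmorphM. Qed.

Lemma germ_opp U (hU : oset U x) s : stalk_opp (germ hU s) = germ hU (- s).
Proof.
apply/germ_eq => /=; have [Z [hZ [hZU [Zx e]]]] := germ_repr hU s.
by exists Z, hZ, hZU; split=> //; rewrite !rmorphN e.
Qed.

Lemma germ_0 U (hU : oset U x) : stalk0 = germ hU 0.
Proof. by rewrite /stalk0 -(germ_res _ _ hU (@opens_top _ U)) rmorph0. Qed.
Lemma germ_1 U (hU : oset U x) : stalk1 = germ hU 1.
Proof. by rewrite /stalk1 -(germ_res _ _ hU (@opens_top _ U)) rmorph1. Qed.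

Fact stalk_addA : associative stalk_add.
Proof.
move=> a b c; have [U [hU [s [t [r [-> -> ->]]]]]] := germP3 a b c.
by rewrite !germ_add addrA.
Qed.
Fact stalk_addC : commutative stalk_add.
Proof.
move=> a b; have [U [hU [s [t [-> ->]]]]] := germP2 a b.
by rewrite !germ_add addrC.
Qed.
Fact stalk_add0 : left_id stalk0 stalk_add.
Proof. by move=> a; have [U [hU [s ->]]] := germP a; rewrite (germ_0 hU) germ_add add0r. Qed.
Fact stalk_addN : left_inverse stalk0 stalk_opp stalk_add.
Proof.
move=> a; have [U [hU [s ->]]] := germP a.
by rewrite (germ_0 hU) germ_opp germ_add addNr.
Qed.
HB.instance Definition _ :=
  GRing.isZmodule.Build stalk stalk_addA stalk_addC stalk_add0 stalk_addN.

Fact stalk_mulA : associative stalk_mul.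
Proof.
move=> a b c; have [U [hU [s [t [r [-> -> ->]]]]]] := germP3 a b c.
by rewrite !germ_mul mulrA.
Qed.
Fact stalk_mulC : commutative stalk_mul.
Proof.
move=> a b; have [U [hU [s [t [-> ->]]]]] := germP2 a b.
by rewrite !germ_mul mulrC.
Qed.
Fact stalk_mul1 : left_id stalk1 stalk_mul.
Proof. by move=> a; have [U [hU [s ->]]] := germP a; rewrite (germ_1 hU) germ_mul mul1r. Qed.
Fact stalk_mulD : left_distributive stalk_mul +%R.
Proof.
move=> a b c; have [U [hU [s [t [r [-> -> ->]]]]]] := germP3 a b c.
change (stalk_mul (stalk_add (germ hU s) (germ hU t)) (germ hU r) =
  stalk_add (stalk_mul (germ hU s) (germ hU r)) (stalk_mul (germ hU t) (germ hU r))).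
by rewrite !(germ_add, germ_mul) mulrDl.
Qed.
HB.instance Definition _ := GRing.Zmodule_isComPzRing.Build stalk
  stalk_mulA stalk_mulC stalk_mul1 stalk_mulD.

Fact germ_is_zmod_morphism U (hU : oset U x) : zmod_morphism (germ hU).
Proof. by move=> s t; rewrite -germ_add -germ_opp. Qed.
Fact germ_is_monoid_morphism U (hU : oset U x) : monoid_morphism (germ hU).
Proof. by split=> [|s t]; [rewrite -germ_1 | rewrite -germ_mul]. Qed.
HB.instance Definition _ U (hU : oset U x) :=
  GRing.isZmodMorphism.Build (sec V U) stalk (germ hU) (@germ_is_zmod_morphism U hU).
HB.instance Definition _ U (hU : oset U x) :=
  GRing.isMonoidMorphism.Build (sec V U) stalk (germ hU) (@germ_is_monoid_morphism U hU).

End Stalk.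

Section SchemeStalk.
Variables (V : scheme) (x : V).

Definition is_nonunit (R : comPzRingType) (a : R) : Prop := ~ exists b, a * b = 1.

Lemma prime_idealX (A : comPzRingType) (P : set A) f n :
  prime_ideal P -> ~ P f -> ~ P (f ^+ n).
Proof.
move=> [_ P1 PM] Pf; elim: n => [|n IH]; first by rewrite expr0.
by rewrite exprS => /PM[].
Qed.

Lemma stalk_chart : exists (A : comPzRingType) (P : set A)
    (g : {rmorphism A -> stalk x}),
  [/\ prime_ideal P,
      forall f, ~ P f -> exists u, g f * u = 1,
      forall z, exists f a, ~ P f /\ z * g f = g a
    & forall a, g a = 0 -> exists f, ~ P f /\ f * a = 0].
Proof.
have [U hU [A [alpha [phi [phiP _ _ zar loc]]]]] := scheme_charts x.
have Dop f : open [set y | oset U y /\ ~ phi y f].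
  apply/zar; first by move=> y [].
  by move=> y [Uy Hy]; exists f.
pose D f := Opens (Dop f).
have hD f : D f `<=` U by move=> y [].
have locD f := loc f (D f) (hD f) (fun y => iff_refl _).
have Px := phiP _ hU.
have small W : open W -> W x -> exists2 f, ~ phi x f & D f `<=` W.
  move=> oW Wx; have : open (W `&` oset U) by apply: openI => //; exact: oset_open.
  move=> /(zar _ (@subIsetr _ _ _))/(_ x (conj Wx hU))[f Hf fW].
  by exists f => // y [Uy Hy]; case: (fW y Uy Hy).
exists A, (phi x), (germ hU \o alpha); split=> //.
- move=> f Hf; have [[g Hg] _ _] := locD f.
  have Dx : oset (D f) x by [].
  exists (germ Dx g) => /=.
  by rewrite -(germ_res _ _ Dx (hD f)) -rmorphM Hg rmorph1.
- move=> z; have [W [hW [s ->]]] := germP z.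
  have [f Hf fW] := small _ (oset_open W) hW.
  have Dx : oset (D f) x by [].
  have [_ /(_ (res fW s))[n [a Ha]] _] := locD f.
  exists (f ^+ n), a; split; first exact: prime_idealX.
  rewrite /= -(germ_res _ _ Dx fW) -(germ_res _ _ Dx (hD f)) -rmorphM !rmorphXn.
  by rewrite Ha; exact: germ_res.
- move=> a /= /eqP; rewrite -(rmorph0 (germ hU)) => /eqP.
  move=> /germ_eq[Z [h [h' [Zx e]]]].
  have [f Hf fZ] := small _ (oset_open Z) Zx.
  have [_ _ /(_ a)[|n Hn]] := locD f.
    by rewrite -(res_comp h fZ) e rmorph0 rmorph0.
  by exists (f ^+ n); split=> //; apply: prime_idealX.
Qed.

Fact stalk_1neq0 : (1 : stalk x) != 0.
Proof.
have [A [P [g [[iP P1 PM] _ _ g0]]]] := stalk_chart.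
apply/eqP; rewrite -(rmorph1 g) => /g0[f [Hf]]; rewrite mulr1 => f0.
by apply: Hf; rewrite f0; apply: ideal0.
Qed.

Fact stalk_local (a b : stalk x) : is_nonunit a -> is_nonunit b -> is_nonunit (a + b).
Proof.
have [A [P [g [[iP P1 PM] gU gS g0]]]] := stalk_chart.
have fracP z f c : ~ P f -> z * g f = g c -> is_nonunit z <-> P c.
  move=> Hf e; split=> [nz|Pc [w Hw]].
    apply: contrapT => /gU[u Hu]; apply: nz; exists (g f * u).
    by rewrite mulrA e.
  have [h [d [Hh e']]] := gS w.
  have /g0[s [Hs]] : g (f * h - c * d) = 0.
    rewrite rmorphB !rmorphM -e -e'; apply/eqP; rewrite subr_eq0; apply/eqP.
    by rewrite mulrACA Hw mul1r.
  rewrite mulrBr => /eqP; rewrite subr_eq0 => /eqP Es.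
  have : P (s * (f * h)) by rewrite Es [c * d]mulrC mulrA; apply: idealM.
  by move=> /PM[//|/PM[]].
have [f [c [Hf e]]] := gS a; have [h [d [Hh e']]] := gS b.
move=> /(fracP _ _ _ Hf e) Pc /(fracP _ _ _ Hh e') Pd.
apply/(fracP (a + b) (f * h) (h * c + f * d)).
- by move=> /PM[].
- by rewrite rmorphD !rmorphM -e -e' mulrDl mulrA [g h * _]mulrC [g f * (b * _)]mulrCA.
- by apply: idealD => //; apply: idealM.
Qed.

End SchemeStalk.

Record localRing := LocalRing {
  local_sort :> comNzRingType;
  local_add : forall a b : local_sort,
    is_nonunit a -> is_nonunit b -> is_nonunit (a + b) }.

HB.instance Definition _ (V : scheme) (x : V) :=
  GRing.PzSemiRing_isNonZero.Build (stalk x) (stalk_1neq0 x).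

Definition local_stalk (V : scheme) (x : V) : localRing :=
  LocalRing (@stalk_local V x).

Section Graded.
Variable R : localRing.

Definition maxid : set R := [set a | is_nonunit a].

Lemma maxid_ideal : is_ideal maxid.
Proof.
split=> [[b]|a b|a b nb [c Hc]]; first by rewrite mul0r => /esym/eqP; rewrite oner_eq0.
  exact: local_add.
by apply: nb; exists (a * c); rewrite mulrCA mulrA.
Qed.

Lemma maxid1 : ~ maxid 1.
Proof. by apply; exists 1; rewrite mulr1. Qed.

Definition maxidb (a : R) : bool := `[< maxid a >].

Fact maxidb_closed : idealr_closed maxidb.
Proof.
split=> [||a u v /asboolP Hu /asboolP Hv].
- by apply/asboolP; apply: ideal0; apply: maxid_ideal.
- by apply/asboolP; apply: maxid1.
- by apply/asboolP; apply: (idealD maxid_ideal) => //; apply: (idealM _ maxid_ideal).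
Qed.
HB.instance Definition _ := isIdealr.Build R maxidb maxidb_closed.

Definition residue := {ideal_quot (maxidb : idealr R)}.
HB.instance Definition _ := GRing.ComNzRing.on residue.

Definition residue_inv (a : residue) : residue :=
  xget 0 [set b | b * a = 1].

Lemma residue_eq (a b : R) : \pi_residue a = \pi_residue b <-> maxid (a - b).
Proof.
split=> [/eqP|H]; first by rewrite -Quotient.idealrBE => /asboolP.
by apply/eqP; rewrite -Quotient.idealrBE; apply/asboolP.
Qed.

Fact residue_mulV (a : residue) : a != 0 -> residue_inv a * a = 1.
Proof.
elim/quotW: a => a a0; rewrite /residue_inv; case: xgetP => [b _ //|].
have [[c Hc]|na] := pselect (exists c, a * c = 1).
  by move=> /(_ (\pi c)); case; rewrite /= -rmorphM mulrC Hc rmorph1.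
case/negP: a0; apply/eqP; rewrite -[RHS](rmorph0 \pi_residue).
by apply/residue_eq; rewrite subr0.
Qed.

Fact residue_inv0 : residue_inv 0 = 0.
Proof.
rewrite /residue_inv; case: xgetP => [b _ /=|//].
by rewrite mulr0 => /esym/eqP; rewrite oner_eq0.
Qed.
HB.instance Definition _ :=
  GRing.ComNzRing_isField.Build residue residue_mulV residue_inv0.

(* gr R is constructed as the quotient of the subring of R[T] of the          *)
(* polynomials sum_n a_n T^n with a_n in m^n, by the ideal where a_n is in    *)
(* m^(n+1) for all n; as a group this is the direct sum of the m^n/m^(n+1).   *)
Definition in_filt (d : nat) (p : {poly R}) : bool :=
  `[< forall i, ideal_pow maxid (d + i) p`_i >].

Fact filt_closed : subring_closed (in_filt 0).
Proof.
split=> [|p q /asboolP Hp /asboolP Hq|p q /asboolP Hp /asboolP Hq].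
- apply/asboolP => -[|i] //; rewrite coef1; apply: ideal0; apply: ideal_pow_ideal.
- apply/asboolP => i; rewrite coefB; have iI := ideal_pow_ideal maxid (0 + i).
  by apply: (idealD iI); [apply: Hp|apply: (idealN iI); apply: Hq].
- apply/asboolP => i; rewrite coefM; apply: ideal_sum; first exact: ideal_pow_ideal.
  move=> j _; have -> : (0 + i = (0 + j) + (0 + (i - j)))%N.
    by rewrite !add0n subnKC // -ltnS.
  by apply: ideal_pow_mul.
Qed.
HB.instance Definition _ := GRing.isSubringClosed.Build {poly R} (in_filt 0) filt_closed.

Definition filt := {p : {poly R} | in_filt 0 p}.
HB.instance Definition _ := SubType.on filt.
HB.instance Definition _ := Choice.on filt.
HB.instance Definition _ := [SubChoice_isSubComNzRing of filt by <:].

Definition filt1 (p : filt) : bool := in_filt 1 (val p).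

Fact filt1_closed : idealr_closed filt1.
Proof.
split=> [||a u v /asboolP Hu /asboolP Hv].
- by apply/asboolP => i; rewrite rmorph0 coef0; apply: ideal0; apply: ideal_pow_ideal.
- apply/asboolP => /(_ 0%N); rewrite rmorph1 coef1 addn0 (ideal_pow1 maxid_ideal) eqxx.
  exact: maxid1.
- apply/asboolP => i; rewrite rmorphD rmorphM coefD.
  have iI := ideal_pow_ideal maxid (1 + i).
  apply: (idealD iI); last exact: Hv.
  rewrite coefM; apply: ideal_sum => [|j _]; first exact: iI.
  have -> : (1 + i = (0 + j) + (1 + (i - j)))%N by rewrite add0n addnCA subnKC // -ltnS.
  by apply: ideal_pow_mul => //; have /asboolP := valP a; apply.
Qed.
HB.instance Definition _ := isIdealr.Build filt filt1 filt1_closed.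

Definition gr := {ideal_quot (filt1 : idealr filt)}.
HB.instance Definition _ := GRing.ComNzRing.on gr.

Lemma gr_eq (p q : filt) : \pi_gr p = \pi_gr q <->
  forall i, ideal_pow maxid i.+1 ((val p)`_i - (val q)`_i).
Proof.
split=> [/eqP|H].
  rewrite -Quotient.idealrBE => /asboolP H i.
  by have := H i; rewrite rmorphB coefB.
apply/eqP; rewrite -Quotient.idealrBE; apply/asboolP => i.
by rewrite rmorphB coefB; apply: H.
Qed.

(* the class of a in m^n/m^(n+1), in degree n; the value is 0 when a is not in m^n *)
Definition initform (n : nat) (a : R) : gr := \pi_gr (insubd 0 (a *: 'X^n)).

Lemma val_initform n a : ideal_pow maxid n a ->
  val (insubd (0 : filt) (a *: 'X^n)) = a *: 'X^n.
Proof.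
move=> Ha; rewrite insubdK //; apply/asboolP => i.
rewrite coefZ coefXn; case: eqP => [->|_]; rewrite ?mulr1 // mulr0.
by apply: ideal0; apply: ideal_pow_ideal.
Qed.

Lemma initformD n a b : ideal_pow maxid n a -> ideal_pow maxid n b ->
  initform n (a + b) = initform n a + initform n b.
Proof.
move=> Ha Hb; rewrite /initform -rmorphD; congr (\pi _); apply: val_inj.
rewrite rmorphD /= !val_initform ?scalerDl //.
by apply: idealD => //; apply: ideal_pow_ideal.
Qed.

Lemma initformM n m a b : ideal_pow maxid n a -> ideal_pow maxid m b ->
  initform (n + m) (a * b) = initform n a * initform m b.
Proof.
move=> Ha Hb; rewrite /initform -rmorphM; congr (\pi _); apply: val_inj.
rewrite rmorphM /= !val_initform //; last exact: ideal_pow_mul.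
by rewrite -scalerAl -scalerAr scalerA exprD.
Qed.

Lemma initform_eq n a b : ideal_pow maxid n a -> ideal_pow maxid n b ->
  initform n a = initform n b <-> ideal_pow maxid n.+1 (a - b).
Proof.
move=> Ha Hb; rewrite gr_eq !val_initform //; split=> [/(_ n)|H i].
  by rewrite !coefZ coefXn eqxx !mulr1.
rewrite !coefZ coefXn; case: eqP => [->|_]; rewrite ?mulr1 // !mulr0 subr0.
by apply: ideal0; apply: ideal_pow_ideal.
Qed.

Definition gr_const (c : residue) : gr := initform 0 (repr c).

Lemma gr_constE (a : R) : gr_const (\pi a) = initform 0 a.
Proof.
apply/initform_eq => //; rewrite (ideal_pow1 maxid_ideal).
by apply/residue_eq; rewrite reprK.
Qed.

Fact gr_const_is_zmod_morphism : zmod_morphism gr_const.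
Proof.
elim/quotW=> a; elim/quotW=> b; rewrite -rmorphB !gr_constE.
by apply/eqP; rewrite eq_sym subr_eq -initformD // subrK.
Qed.
Fact gr_const_is_monoid_morphism : monoid_morphism gr_const.
Proof.
split.
  rewrite -(rmorph1 \pi_residue) gr_constE /initform -[RHS](rmorph1 \pi_gr).
  by congr (\pi _); apply: val_inj; rewrite val_initform // rmorph1 scale1r expr0.
elim/quotW=> a; elim/quotW=> b; rewrite -rmorphM !gr_constE.
by rewrite -initformM.
Qed.
HB.instance Definition _ :=
  GRing.isZmodMorphism.Build residue gr gr_const gr_const_is_zmod_morphism.
HB.instance Definition _ :=
  GRing.isMonoidMorphism.Build residue gr gr_const gr_const_is_monoid_morphism.

Definition gr_scale (c : residue) (u : gr) : gr := gr_const c * u.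
Fact gr_scaleA a b v : gr_scale a (gr_scale b v) = gr_scale (a * b) v.
Proof. by rewrite /gr_scale rmorphM mulrA. Qed.
Fact gr_scale1 : left_id 1 gr_scale.
Proof. by move=> u; rewrite /gr_scale rmorph1 mul1r. Qed.
Fact gr_scaleDr : right_distributive gr_scale +%R.
Proof. by move=> c u v; rewrite /gr_scale mulrDr. Qed.
Fact gr_scaleDl v : {morph gr_scale^~ v : a b / a + b}.
Proof. by move=> a b; rewrite /gr_scale rmorphD mulrDl. Qed.
HB.instance Definition _ := GRing.Zmodule_isLmodule.Build residue gr
  gr_scaleA gr_scale1 gr_scaleDr gr_scaleDl.
Fact gr_scaleAl (a : residue) (u v : gr) : a *: (u * v) = (a *: u) * v.
Proof. exact: mulrA. Qed.
HB.instance Definition _ := GRing.Lmodule_isLalgebra.Build residue gr gr_scaleAl.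
HB.instance Definition _ := GRing.Lalgebra_isComAlgebra.Build residue gr.

Definition gr1b (u : gr) : bool :=
  `[< exists2 a, maxid a & u = initform 1 a >].

Fact gr1b_closed : submod_closed gr1b.
Proof.
have m1 a : maxid a -> ideal_pow maxid 1 a by rewrite (ideal_pow1 maxid_ideal).
split=> [|c u v /asboolP[a Ha ->] /asboolP[b Hb ->]]; apply/asboolP.
  exists 0; first by apply: ideal0; apply: maxid_ideal.
  rewrite -[LHS](rmorph0 \pi_gr); congr (\pi _); apply: val_inj.
  rewrite val_initform; last by apply: ideal0; apply: ideal_pow_ideal.
  by rewrite rmorph0 scale0r.
elim/quotW: c => c; exists (c * a + b).
  by apply: (idealD maxid_ideal) => //; apply: (idealM _ maxid_ideal).
have Hca : maxid (c * a) by apply: (idealM _ maxid_ideal).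
rewrite initformD; try exact: m1.
have -> : initform 1 (c * a) = initform 0 c * initform 1 a.
  by rewrite -initformM //; exact: m1.
by rewrite -gr_constE.
Qed.
HB.instance Definition _ := GRing.isSubmodClosed.Build residue gr gr1b gr1b_closed.

(* m/m^2 *)
Definition cotangent := {u : gr | gr1b u}.
HB.instance Definition _ := SubType.on cotangent.
HB.instance Definition _ := Choice.on cotangent.
HB.instance Definition _ := [SubChoice_isSubLmodule of cotangent by <:].

(* For R regular, gr R is the symmetric algebra of m/m^2 and these are the    *)
(* rational points of the tangent space Spec (gr R).                          *)
Definition tangent_vector := {linear cotangent -> residue^o}.

End Graded.

Section Cone.
Variables (R : localRing) (I : nat -> set R).

(* only meaningful when I n is contained in m^n for all n > 0 *)
Definition init_ideal : set (gr R) :=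
  ideal_gen [set u | exists n a, [/\ (0 < n)%N, I n a & u = initform n a]].

(* the closed subset of Spec (gr R), as a set of prime ideals *)
Definition cone : set (set (gr R)) :=
  [set P | prime_ideal P /\ init_ideal `<=` P].

(* The comorphism of the translation by v is the k(x)-algebra endomorphism of *)
(* gr R with xi |-> xi + v(xi) on linear forms; it is unique, and it exists   *)
(* when R is regular.                                                         *)
Definition is_translation (v : tangent_vector R) (t : {lrmorphism gr R -> gr R}) :=
  forall xi : cotangent R, t (val xi) = val xi + (v xi)%:A.

Definition translation_stable (v : tangent_vector R) : Prop :=
  exists t, is_translation v t /\ [set t @^-1` P | P in cone] = cone.

Definition linear_subspace (L : set (tangent_vector R)) : Prop :=
  L !=set0 /\
  forall (c : residue R) (u v w : tangent_vector R), L u -> L v ->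
    (forall xi, w xi = c * u xi + v xi) -> L w.

Definition stable_subspace (L : set (tangent_vector R)) : Prop :=
  linear_subspace L /\ L `<=` translation_stable.

(* The largest stable linear subspace, by vertex_space_stable and             *)
(* vertex_space_largest.                                                      *)
Definition vertex_space : set (tangent_vector R) :=
  [set v | exists2 L, stable_subspace L & L v].

End Cone.

(* a family of c tangent vectors induces a basis of the quotient by L *)
Definition has_codim (R : localRing) (L : set (tangent_vector R)) (c : nat) : Prop :=
  exists e : 'I_c -> tangent_vector R, forall w : tangent_vector R,
    exists! a : 'rV[residue R]_c, exists2 l, L l &
      forall xi, w xi = \sum_i a 0 i * e i xi + l xi.

(* A finite codimension is unique; it is finite for R noetherian, the default *)
(* value 0 being used otherwise.                                              *)
Definition codim (R : localRing) (L : set (tangent_vector R)) : nat :=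
  xget 0%N [set c | has_codim L c].

Section VertexSpace.
Variables (R : localRing) (I : nat -> set R).

Lemma translation_stableD (u v w : tangent_vector R) :
  translation_stable I u -> translation_stable I v ->
  (forall xi, w xi = u xi + v xi) -> translation_stable I w.
Proof.
move=> [t [tu tC]] [s [sv sC]] Hw; exists (t \o s); split=> [xi|].
  rewrite [LHS]/= sv; transitivity (t (val xi) + t (v xi)%:A); first exact: rmorphD.
  by rewrite tu linearZ rmorph1 Hw scalerDl addrA.
rewrite -{2}sC -{2}tC; apply/seteqP; split=> _ [P HP <-].
  by exists (t @^-1` P) => //; exists P.
by case: HP => Q HQ <-; exists Q.
Qed.

Lemma translation_stable0 (v : tangent_vector R) :
  (forall xi, v xi = 0) -> translation_stable I v.
Proof.
move=> v0; exists idfun; split=> [xi|]; first by rewrite v0 scale0r addr0.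
by apply/seteqP; split=> [_ [P HP <-]//|P HP]; exists P.
Qed.

Lemma zero_subspace : stable_subspace I [set v | forall xi, v xi = 0].
Proof.
split; last by move=> v; apply: translation_stable0.
split; first by exists (\0 : {linear _ -> _}).
by move=> c u v w u0 v0 Hw xi; rewrite Hw u0 v0 mulr0 addr0.
Qed.

Lemma vertex_space_stable : stable_subspace I (vertex_space I).
Proof.
split; last by move=> v [L [_ LS] /LS].
split.
  have [[v v0] _] := zero_subspace.1; exists v.
  by exists [set v : tangent_vector R | forall xi, v xi = 0] => //; exact: zero_subspace.
move=> c u v w [L1 [[L1n L1c] L1S] L1u] [L2 [[L2n L2c] L2S] L2v] Hw.
exists [set w : tangent_vector R |
  exists u v, [/\ L1 u, L2 v & forall xi, w xi = u xi + v xi]].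
  split; [split|].
  - by exists (u \+ v : {linear _ -> _}); exists u, v.
  - move=> a p1 p2 p [u1 [v1 [Lu1 Lv1 E1]]] [u2 [v2 [Lu2 Lv2 E2]]] Ep.
    exists (a \*: u1 \+ u2 : {linear _ -> _}), (a \*: v1 \+ v2 : {linear _ -> _}); split.
    + exact: (L1c a u1 u2).
    + exact: (L2c a v1 v2).
    + by move=> xi; rewrite Ep E1 E2 mulrDr addrACA.
  - by move=> p [u1 [v1 [/L1S ? /L2S ? ?]]]; apply: (translation_stableD (u := u1) (v := v1)).
have [z Lz] := L1n.
exists (c \*: u : {linear _ -> _}), v; split=> //.
apply: (L1c c u (0 \*: u : {linear _ -> _})) => //=.
  by apply: (L1c (-1) u u) => // xi /=; rewrite scale0r mulN1r addNr.
by move=> xi; rewrite scale0r addr0.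
Qed.

Lemma vertex_space_largest L : stable_subspace I L -> L `<=` vertex_space I.
Proof. by move=> HL v Lv; exists L. Qed.

End VertexSpace.

(* sum_n J_n W^n is a graded A-subalgebra of A[W] *)
Definition graded_subalgebra (A : comPzRingType) (J : nat -> set A) : Prop :=
  [/\ forall n, is_ideal (J n), J 0%N = setT
    & forall m n a b, J m a -> J n b -> J (m + n)%N (a * b)].

(* the degree m component of A[f_1 W^(d_1), ..., f_r W^(d_r)] *)
Definition gen_component (A : comPzRingType) (r : nat) (d : 'I_r -> nat)
    (f : 'I_r -> A) (m : nat) : set A :=
  [set a | forall J, graded_subalgebra J -> (forall i, J (d i) (f i)) -> J m a].

Record reesAlgebra (V : ringedSpace) := ReesAlgebra {
  rcomp :> forall (n : nat) (U : opens V), set (sec V U);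
  rcomp_graded : forall U, graded_subalgebra (fun n => @rcomp n U);
  rcomp_res : forall n (U W : opens V) (h : W `<=` U) (s : sec V U),
    rcomp n s -> rcomp n (res h s);
  rcomp_local : forall n (U : opens V) (s : sec V U),
    (forall x, oset U x -> exists (W : opens V) (h : W `<=` U),
       oset W x /\ rcomp n (res h s)) -> rcomp n s;
  rcomp_fg : forall x : V, exists2 U : opens V, oset U x &
    exists (r : nat) (d : 'I_r -> nat) (f : 'I_r -> sec V U),
      (forall i, (0 < d i)%N) /\
      forall n (W : opens V) (hW : W `<=` U) (g : sec V W),
        rcomp n g <->
        forall y, oset W y -> exists (Z : opens V) (hZ : Z `<=` W), oset Z y /\
          gen_component d (fun i => res (subset_trans hZ hW) (f i)) n (res hZ g) }.

Section Tau.
Variables (V : scheme) (G : reesAlgebra V).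

Definition stalk_component (x : V) (n : nat) : set (local_stalk x) :=
  [set a | exists (U : opens V) (hU : oset U x) (s : sec V U),
     G n _ s /\ a = germ hU s].

Arguments stalk_component : clear implicits.

(* the order of J is the largest n with J contained in m^n, or infinity *)
Definition order_ge (R : localRing) (J : set R) (n : nat) : Prop :=
  J `<=` ideal_pow (@maxid R) n.

Definition Sing : set V :=
  [set x | forall n, (0 < n)%N -> order_ge (stalk_component x n) n].

Definition tau (x : V) : nat := codim (vertex_space (stalk_component x)).

Definition rees_stalk (x : V) : set {poly local_stalk x} :=
  [set F | forall n, stalk_component x n F`_n].

End Tau.

Arguments stalk_component {V} G x n.
Arguments rees_stalk {V} G x.

Definition integral_over (A : comNzRingType) (S : set A) (F : A) : Prop :=
  exists p : {poly A}, [/\ p \is monic, forall i, S p`_i & root p F].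

(* sections over U of the sheaf O_V[W]: locally finite sums of a_i W^i *)
Definition poly_section (V : ringedSpace) (U : opens V) (a : nat -> sec V U) : Prop :=
  forall x, oset U x -> exists (W : opens V) (h : W `<=` U) (d : nat),
    oset W x /\ forall i, (d <= i)%N -> res h (a i) = 0.

(* Sections over U of the integral closure of G in O_V[W]: being locally      *)
(* integral over G is the same as having all germs integral over the stalks.  *)
Definition int_closure (V : scheme) (G : reesAlgebra V) (U : opens V)
    (a : nat -> sec V U) : Prop :=
  poly_section a /\
  forall (x : V) (hx : oset U x), exists2 d : nat,
    forall i, (d <= i)%N -> germ hx (a i) = 0 &
    integral_over (rees_stalk G x)
      (\poly_(i < d) (germ hx (a i) : local_stalk x)).

Definition integrally_equivalent (V : scheme) (G G' : reesAlgebra V) : Prop :=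
  forall (U : opens V) (a : nat -> sec V U), int_closure G a <-> int_closure G' a.

(* Main.v *)
From HB Require Import structures.
Require Import Defs.
From mathcomp Require Import all_boot all_order all_algebra.
From mathcomp Require Import ring_quotient generic_quotient.
From mathcomp Require Import boolp classical_sets topology.
Import GRing.Theory.
Local Open Scope classical_set_scope.
Local Open Scope ring_scope.
Local Open Scope quotient_scope.

Set Implicit Arguments.
Unset Strict Implicit.
Unset Printing Implicit Defensive.

(* A homogeneous element a W^n of G' is integral over G, so a^N is a sum of   *)
(* terms c_i a^i with c_i in I_(n(N-i)). When x lies in both singular loci,   *)
(* passing to initial forms shows that the initial ideals of G and G' have    *)
(* the same radical, hence the same cone, the same space of vertices and the  *)
(* same tau. If only x in Sing(G) is known, the same equation gives           *)
(* a^N in m^(jN+1) whenever a is in m^j with j < n, so a is in m^n as soon as *)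
(* gr_m(O_x) is reduced.                                                      *)
(*   Reducedness holds for k[X_1..X_n] at any prime Q: locally Q is           *)
(* generated by a sequence whose initial segments generate primes, and        *)
(* expanding in powers of one generator at a time shows that gr has no zero   *)
(* divisors. It passes to a smooth algebra B = S/J, S polynomial, because     *)
(* formal smoothness makes B a retract of S/J^n for every n.                  *)

(** * Primes generated by regular sequences *)

(** The graded ideals enter [tau] only through [cone], so it suffices to compare cones ([cone_sub])
    once the singular loci are known to agree ([Sing_sub]). Both comparisons use one equation in the
    local ring, the coefficient of W^(nN) in an integral equation for a W^n ([integral_monomial]).
    Smoothness enters through [gr_reduced]. If a prime I is locally generated by a regular sequence
    as in [regular_flag], then gr_I(A) tensored with A/J is a polynomial ring over A/J, hence a
    domain for J prime; [gr_domain_step] adjoins one variable at a time. [poly_regular_flag]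
    supplies such sequences for polynomial rings over a field, [smooth_alg_reduced] descends to
    smooth algebras and [localization_gr_reduced] passes to stalks. *)

Section IdealProducts.
Variable A : comPzRingType.
Implicit Types I J K L : set A.

Definition ideal_mul J K : set A :=
  ideal_gen [set c | exists a b, [/\ J a, K b & c = a * b]].

Lemma ideal_mul_ideal J K : is_ideal (ideal_mul J K).
Proof. exact: ideal_gen_ideal. Qed.

Lemma ideal_mulM J K a b : J a -> K b -> ideal_mul J K (a * b).
Proof. by move=> Ja Kb; apply: sub_ideal_gen; exists a, b. Qed.

Lemma ideal_mul_min J K L :
  is_ideal L -> (forall a b, J a -> K b -> L (a * b)) -> ideal_mul J K `<=` L.
Proof. by move=> iL H c; apply=> // _ [a [b [Ja Kb ->]]]; apply: H. Qed.

Lemma ideal_mulS J J' K K' :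
  J `<=` J' -> K `<=` K' -> ideal_mul J K `<=` ideal_mul J' K'.
Proof.
move=> JJ KK; apply: ideal_mul_min; first exact: ideal_mul_ideal.
by move=> a b /JJ Ja /KK Kb; apply: ideal_mulM.
Qed.

Lemma ideal_powS J K n : J `<=` K -> ideal_pow J n `<=` ideal_pow K n.
Proof. by move=> JK; elim: n => [//|n IH]; apply: ideal_mulS. Qed.

Lemma ideal_pow_le J m n : (m <= n)%N -> ideal_pow J n `<=` ideal_pow J m.
Proof.
move=> /subnK <-; elim: (n - m)%N => [//|d IH]; apply: subset_trans IH.
apply: ideal_mul_min; first exact: ideal_pow_ideal.
by move=> a b _; apply: idealM; apply: ideal_pow_ideal.
Qed.

Lemma ideal_pow_exp J a n : J a -> ideal_pow J n (a ^+ n).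
Proof. by move=> Ja; elim: n => [//|n IH]; rewrite exprS; apply: ideal_mulM. Qed.

Lemma ideal_powX J m n a : ideal_pow J m a -> ideal_pow J (m * n) (a ^+ n).
Proof.
move=> Ja; elim: n => [|n IH]; first by rewrite muln0.
by rewrite mulnS exprS; apply: ideal_pow_mul.
Qed.

Lemma ideal_mulr J a b : is_ideal J -> J a -> J (a * b).
Proof. by rewrite mulrC; apply: idealM. Qed.

Lemma idealB J a b : is_ideal J -> J a -> J b -> J (a - b).
Proof. by move=> iJ Ja Jb; apply: idealD => //; apply: idealN. Qed.

Lemma prime_idealM J a b : prime_ideal J -> ~ J a -> ~ J b -> ~ J (a * b).
Proof. by move=> [_ _ H] na nb /H[]. Qed.

End IdealProducts.

Section RegularFlag.
Variables (A : comNzRingType) (Q : set A).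
Hypothesis primeQ : prime_ideal Q.
Implicit Types (I J E F : set A) (H : nat -> set A).

Let idQ : is_ideal Q. Proof. by case: primeQ. Qed.
Let notQ1 : ~ Q 1. Proof. by case: primeQ. Qed.
Let notQM s t : ~ Q s -> ~ Q t -> ~ Q (s * t).
Proof. exact: prime_idealM. Qed.

(* contraction to A of the extension to the localization at Q *)
Definition sat E : set A := [set a | exists2 s, ~ Q s & E (s * a)].

Lemma sub_sat E : E `<=` sat E.
Proof. by move=> a Ea; exists 1 => //; rewrite mul1r. Qed.

Lemma sat_ideal E : is_ideal E -> is_ideal (sat E).
Proof.
move=> iE; split=> [|a b [s Qs Ea] [t Qt Eb]|a b [s Qs Eb]].
- by apply: sub_sat; apply: ideal0.
- exists (s * t); first exact: notQM.
  rewrite mulrDr; apply: idealD => //; last by rewrite -mulrA; apply: idealM.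
  by rewrite mulrAC; apply: ideal_mulr.
- by exists s => //; rewrite mulrCA; apply: idealM.
Qed.

Lemma satS E F : E `<=` F -> sat E `<=` sat F.
Proof. by move=> EF a [s Qs /EF]; exists s. Qed.

Lemma sat_cancel E s a : ~ Q s -> sat E (s * a) -> sat E a.
Proof. by move=> Qs [t Qt Ea]; exists (t * s); [exact: notQM|rewrite -mulrA]. Qed.

Lemma sat_mul (E F K : set A) a b :
  (forall c d, E c -> F d -> K (c * d)) -> sat E a -> sat F b -> sat K (a * b).
Proof.
move=> EFK [s Qs Ea] [t Qt Fb]; exists (s * t); first exact: notQM.
by rewrite mulrACA; apply: EFK.
Qed.

(** The traces on A of I^n A_Q and of J I^n A_Q. For I inside J, their quotient stands for the
    degree n part of gr_I(A) tensored with A/J. *)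
Definition spow I n := sat (ideal_pow I n).
Definition smul J I n := sat (ideal_mul J (ideal_pow I n)).

Lemma spow_ideal I n : is_ideal (spow I n).
Proof. by apply: sat_ideal; apply: ideal_pow_ideal. Qed.
Lemma smul_ideal J I n : is_ideal (smul J I n).
Proof. by apply: sat_ideal; apply: ideal_mul_ideal. Qed.
Lemma spow0 I a : spow I 0 a. Proof. by apply: sub_sat. Qed.
Lemma spow_le I m n : (m <= n)%N -> spow I n `<=` spow I m.
Proof. by move=> mn; apply: satS; apply: ideal_pow_le. Qed.
Lemma smul_le J I m n : (m <= n)%N -> smul J I n `<=` smul J I m.
Proof. by move=> mn; apply: satS; apply: ideal_mulS; [move=> ? |exact: ideal_pow_le]. Qed.
Lemma spowM I m n a b : spow I m a -> spow I n b -> spow I (m + n) (a * b).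
Proof. by apply: sat_mul => c d; apply: ideal_pow_mul. Qed.

Lemma smul_spow J I n : smul J I n `<=` spow I n.
Proof.
apply: satS; apply: ideal_mul_min; first exact: ideal_pow_ideal.
by move=> a b _; apply: idealM; apply: ideal_pow_ideal.
Qed.

Lemma smulM J I m n a b : smul J I m a -> spow I n b -> smul J I (m + n) (a * b).
Proof.
apply: sat_mul => c d Hc Hd.
suff: ideal_mul J (ideal_pow I m) `<=` [set c | ideal_mul J (ideal_pow I (m + n)) (c * d)].
  exact.
have iK := ideal_mul_ideal J (ideal_pow I (m + n)).
apply: ideal_mul_min => [|u v Ju Iv] /=.
  split=> [|u v|u v] /=; first by rewrite mul0r; apply: ideal0.
  - by rewrite mulrDl; apply: idealD.
  - by rewrite -mulrA; apply: idealM.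
by rewrite -mulrA; apply: ideal_mulM => //; apply: ideal_pow_mul.
Qed.

(* Localised at Q: the ring gr_I(A) (x) A/J has no zero divisors, for all     *)
(* primes J between I and Q.                                                  *)
Definition gr_domain I := forall J, prime_ideal J -> I `<=` J -> J `<=` Q ->
  forall i j a b, spow I i a -> spow I j b -> smul J I (i + j) (a * b) ->
  smul J I i a \/ smul J I j b.

(** Coefficients of index above n are left free: in use x lies in both I' and J, so these terms fall
    into J I'^n anyway. *)
Definition expansion (x : A) H n : set A :=
  [set a | exists s (c : {poly A}), [/\ ~ Q s, s * a = c.[x] &
     forall p, (p <= n)%N -> H (n - p)%N c`_p]].

Lemma expansion_ideal x H n :
  (forall m, is_ideal (H m)) -> is_ideal (expansion x H n).
Proof.
move=> iH; split=> [|a b [s [c [Qs Ea Hc]]] [t [d [Qt Eb Hd]]]|a b [s [c [Qs Eb Hc]]]].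
- exists 1, 0; split=> //; first by rewrite mulr0 horner0.
  by move=> p _; rewrite coef0; apply: ideal0.
- exists (s * t), (t *: c + s *: d); split; first exact: notQM.
    by rewrite hornerD !hornerZ -Ea -Eb mulrDr mulrA [t * s]mulrC mulrA.
  move=> p pn; rewrite coefD !coefZ; apply: idealD => //; apply: idealM => //.
    exact: Hc.
  exact: Hd.
- exists s, (a *: c); split=> //; first by rewrite hornerZ -Eb mulrCA.
  by move=> p pn; rewrite coefZ; apply: idealM => //; apply: Hc.
Qed.

Lemma expansion_cancel x H n s a :
  ~ Q s -> expansion x H n (s * a) -> expansion x H n a.
Proof.
move=> Qs [t [c [Qt Ea Hc]]]; exists (t * s), c; split=> //; first exact: notQM.
by rewrite -mulrA.
Qed.

Section Step.
Variables (I I' : set A) (x : A).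
Hypotheses (primeI : prime_ideal I) (II' : I `<=` I') (I'Q : I' `<=` Q).
Hypotheses (I'x : I' x) (nIx : ~ I x).
Hypothesis I'_gen : forall a, I' a -> exists s y, ~ Q s /\ I (s * a - y * x).
Hypothesis domI : gr_domain I.

Let IQ : I `<=` Q. Proof. exact: subset_trans I'Q. Qed.
Let idI : is_ideal I. Proof. by case: primeI. Qed.

(** The class of x is nonzero in degree 0, so [gr_domain] with J = I makes it regular. The order of
    a is raised one step at a time, [smul I I m] being [spow I m.+1]. *)
Lemma spow_regular n a : spow I n (x * a) -> spow I n a.
Proof.
suff: forall m, (m <= n)%N -> spow I n (x * a) -> spow I m a by move/(_ n); apply.
elim=> [|m IH] mn Ha; first exact: spow0.
have [//||//|[s Qs]] := domI primeI _ IQ (IH (ltnW mn) Ha) (spow0 I x).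
  by rewrite addn0 mulrC; apply: (spow_le mn).
move=> H; exfalso; apply: (prime_idealM primeI (_ : ~ I s) nIx) => [/IQ//|].
by move: H; apply: (ideal_mul_min idI) => c d Ic _; apply: ideal_mulr.
Qed.

Lemma spow_regularX n r a : spow I n (x ^+ r * a) -> spow I n a.
Proof. by elim: r a => [|r IH] a; rewrite ?mul1r // exprS -mulrA => /spow_regular/IH. Qed.

(** Locally I' = I + (x), so each further factor from I' multiplies the expansion by a linear
    polynomial with constant term in I. *)
Lemma spow_expansion n : spow I' n `<=` expansion x (spow I) n.
Proof.
have iE m := expansion_ideal x m (spow_ideal I).
suff sub : ideal_pow I' n `<=` expansion x (spow I) n.
  by move=> a [s Qs /sub]; apply: expansion_cancel.
elim: n => [|n IH].
  move=> a _; exists 1, a%:P; split=> //; first by rewrite mul1r hornerC.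
  by move=> p; rewrite sub0n => _; apply: spow0.
apply: ideal_mul_min => // a b /I'_gen[s [y [Qs Ia]]] /IH[t [c [Qt Eb Hc]]].
exists (s * t), (((s * a - y * x)%:P + y *: 'X) * c); split.
- exact: notQM.
- by rewrite hornerM hornerD hornerC hornerZ hornerX subrK -Eb mulrACA.
move=> p pn; rewrite mulrDl coefD coefCM -scalerAl coefZ coefXM.
apply: (idealD (spow_ideal _ _)).
  case: (leqP p n) => np; last first.
    have -> : p = n.+1 by apply/eqP; rewrite eqn_leq pn.
    by rewrite subnn; apply: spow0.
  rewrite subSn // -add1n; apply: spowM; last exact: Hc.
  by apply: sub_sat; rewrite (ideal_pow1 idI).
apply: (idealM _ (spow_ideal _ _)); case: p pn => [|p] pn /=.
  by apply: ideal0; apply: spow_ideal.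
by rewrite subSS; apply: Hc.
Qed.

Lemma smul_expansion J n : smul J I' n `<=` expansion x (smul J I) n.
Proof.
have iE := expansion_ideal x n (smul_ideal J I).
move=> a [s Qs Ha]; apply: (expansion_cancel Qs); move: Ha.
apply: ideal_mul_min => // {s Qs} {}a b Ja Hb.
have [t [c [Qt Eb Hc]]] := spow_expansion (sub_sat Hb).
exists t, (a *: c); split=> //; first by rewrite hornerZ -Eb mulrCA.
move=> p pn; rewrite coefZ; have [s Qs Hs] := Hc p pn.
by exists s => //; rewrite mulrCA; apply: ideal_mulM.
Qed.

(** Converse of [smul_expansion]. In a term of index p > n, one factor x is spent in J and n others
    in I'^n. *)
Lemma expansion_smul J n : I' `<=` J -> expansion x (smul J I) n `<=` smul J I' n.
Proof.
move=> I'J a [s [c [Qs Ea Hc]]]; apply: (sat_cancel Qs); rewrite Ea horner_coef.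
apply: ideal_sum; first exact: smul_ideal.
move=> p _; case: (leqP p n) => [pn|np].
  rewrite -{1}(subnK pn); apply: smulM; last first.
    by apply: sub_sat; apply: ideal_pow_exp.
  by apply: satS (Hc _ pn); apply: ideal_mulS; [move=> ? |exact: ideal_powS].
apply: (idealM _ (smul_ideal _ _ _)); rewrite -(subnK np) exprD.
apply: (idealM _ (smul_ideal _ _ _)); rewrite exprS; apply: sub_sat.
by apply: ideal_mulM; [exact: I'J|exact: ideal_pow_exp].
Qed.

(** Uniqueness of expansions modulo J. Let y_r be the sum of c_p x^(p-r) over p >= r. Then x^r y_r
    is minus the sum of the lower terms, which lie in I^(n-r+1); cancelling x^r puts y_r there, and
    c_p = y_p - x y_(p+1) with x in J. *)
Lemma expansion0_smul J n (c : {poly A}) : I' `<=` J ->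
  c.[x] = 0 -> (forall p, spow I (n - p) c`_p) ->
  forall p, (p <= n)%N -> smul J I (n - p) c`_p.
Proof.
move=> I'J cx0 Hc p pn; pose y r := (drop_poly r c).[x].
have Hy r : (r <= n)%N -> spow I (n - r).+1 (y r).
  move=> rn; apply: (@spow_regularX _ r).
  have -> : x ^+ r * y r = - (take_poly r c).[x].
    apply/eqP; rewrite eq_sym -subr_eq0 -opprD oppr_eq0 addrC mulrC; apply/eqP.
    rewrite -[RHS]cx0 -[in RHS](poly_take_drop r c).
    by rewrite hornerD hornerM hornerXn addrC.
  apply: (idealN (spow_ideal _ _)); rewrite horner_coef.
  apply: ideal_sum => [|i _]; first exact: spow_ideal.
  rewrite mulrC; apply: (idealM _ (spow_ideal _ _)).
  rewrite coef_take_poly; case: ltnP => ir; last by apply: ideal0; apply: spow_ideal.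
  by apply: spow_le (Hc i); rewrite -subSn // -(subSS i n) leq_sub2l.
have {}Hy' : spow I (n - p) (y p.+1).
  move: pn; rewrite leq_eqVlt => /predU1P[->|pn]; first by rewrite subnn; apply: spow0.
  by have := Hy _ pn; rewrite -subSn // subSS.
have -> : c`_p = y p - x * y p.+1.
  apply/eqP; rewrite eq_sym subr_eq; apply/eqP; rewrite /y.
  have -> : drop_poly p c = (c`_p)%:P + drop_poly p.+1 c * 'X.
    apply/polyP => i; rewrite coefD coefC coefMX !coef_drop_poly.
    by case: i => [|i]; rewrite ?addr0 // add0r -addSnnS.
  by rewrite hornerD hornerC hornerMX [x * _]mulrC.
have iG := smul_ideal J I (n - p).
apply: idealB => //.
  by apply: satS (Hy p pn); apply: ideal_mulS; [exact: subset_trans II' I'J|move=> ?].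
have [s Qs Hs] := Hy'.
by exists s => //; rewrite mulrCA; apply: ideal_mulM => //; apply: I'J.
Qed.

(** By existence and uniqueness of expansions, gr_I'(A) tensored with A/J is, locally at Q, a
    polynomial ring in the class of x over gr_I(A) tensored with A/J. The lowest-term argument for
    polynomials over a domain then applies. *)
Lemma gr_domain_step : gr_domain I'.
Proof.
move=> J primeJ I'J JQ i j a b Fa Fb Gab.
have IJ : I `<=` J by apply: subset_trans I'J.
have [s [c [Qs Ea Hc]]] := spow_expansion Fa.
have [t [d [Qt Eb Hd]]] := spow_expansion Fb.
have [u [e [Qu Eab He]]] := smul_expansion Gab.
(* Above m, truncated subtraction makes the exponent 0, where [spow] is everything. *)
have extF H (m : nat) (f : {poly A}) : H = spow I ->
    (forall p, (p <= m)%N -> H (m - p)%N f`_p) -> forall p, spow I (m - p) f`_p.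
  move=> -> Hf p; case: (leqP p m) => [/Hf//|/ltnW]; rewrite -subn_eq0 => /eqP ->.
  exact: spow0.
have {}Hc := extF _ _ _ erefl Hc; have {}Hd := extF _ _ _ erefl Hd.
have HeF : forall p, spow I (i + j - p) e`_p.
  by apply: (extF _ _ _ erefl) => p /He; apply: smul_spow.
(* Only an inequality, again because subtraction is truncated. *)
have degF p l : (l <= p)%N -> (i + j - p <= (i - l) + (j - (p - l)))%N.
  move=> lp; rewrite leq_subLR; apply: (@leq_trans (l + (i - l) + ((p - l) + (j - (p - l))))%N).
    by rewrite leq_add // -leq_subLR.
  by rewrite addnACA subnKC.
have Hcd p : spow I (i + j - p) (c * d)`_p.
  rewrite coefM; apply: ideal_sum => [|l _]; first exact: spow_ideal.
  by apply: spow_le (spowM (Hc l) (Hd (p - l)%N)); apply: degF; rewrite -ltnS.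
(* The polynomial u c d - s t e vanishes at x, so uniqueness applies to it; the coefficients of e
   are good by choice. *)
have Gcd p : (p <= i + j)%N -> smul J I (i + j - p) (c * d)`_p.
  move=> pn; have iG := smul_ideal J I (i + j - p).
  have := @expansion0_smul J (i + j) (u *: (c * d) - (s * t) *: e) I'J _ _ p pn.
  rewrite coefB !coefZ => G; apply: (sat_cancel Qu).
  rewrite -[u * _](subrK (s * t * e`_p)); apply: (idealD iG).
    apply: G => [|r].
      rewrite hornerD hornerN !hornerZ hornerM -Ea -Eb -Eab.
      by rewrite [s * a * _]mulrACA [u * (s * t * _)]mulrCA subrr.
    rewrite coefB !coefZ; have iF := spow_ideal I (i + j - r).
    by apply: (idealB iF); apply: (idealM _ iF).
  by apply: (idealM _ iG); apply: He.
have [Ga|/existsNP[p0 /not_implyP[p0i Hp0]]] :=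
    pselect (forall p, (p <= i)%N -> smul J I (i - p) c`_p).
  by left; apply: expansion_smul => //; exists s, c.
have [Gb|/existsNP[q0 /not_implyP[q0j Hq0]]] :=
    pselect (forall q, (q <= j)%N -> smul J I (j - q) d`_q).
  by right; apply: expansion_smul => //; exists t, d.
exfalso.
(* Let c_p and d_q be the lowest bad coefficients. All other terms of the coefficient of index p + q
   of c d are good, hence so is c_p d_q. *)
have exN (H : nat -> Prop) m : ~ H m -> exists m, `[< ~ H m >].
  by move=> Hm; exists m; apply/asboolP.
have [p /asboolP Hp minp] := ex_minnP (exN (fun p => smul J I (i - p) c`_p) _ Hp0).
have [q /asboolP Hq minq] := ex_minnP (exN (fun q => smul J I (j - q) d`_q) _ Hq0).
have pi : (p <= i)%N by apply: leq_trans p0i; apply: minp; apply/asboolP.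
have qj : (q <= j)%N by apply: leq_trans q0j; apply: minq; apply/asboolP.
have ltp l : (l < p)%N -> smul J I (i - l) c`_l.
  by move=> lp; apply: contrapT => /asboolP/minp; rewrite leqNgt lp.
have ltq l : (l < q)%N -> smul J I (j - l) d`_l.
  by move=> lq; apply: contrapT => /asboolP/minq; rewrite leqNgt lq.
have : smul J I ((i - p) + (j - q)) (c`_p * d`_q).
  have pqn : (p + q <= i + j)%N by apply: leq_add.
  have -> : ((i - p) + (j - q) = i + j - (p + q))%N.
    by apply/eqP; rewrite -(eqn_add2r (p + q)) subnK // addnACA !subnK.
  have iG := smul_ideal J I (i + j - (p + q)).
  have lpq : (p < (p + q).+1)%N by rewrite ltnS leq_addr.
  have := Gcd _ pqn; rewrite coefM (bigD1 (Ordinal lpq)) //= addKn => Gs.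
  rewrite -[_ * _](addrK (\sum_(l < (p + q).+1 | l != Ordinal lpq) c`_l * d`_(p + q - l))).
  apply: (idealB iG Gs).
  apply: ideal_sum => // l lp.
  have lpq' : (l <= p + q)%N by rewrite -ltnS.
  case: (ltngtP l p) => [ll|gl|/eqP]; last by move=> /eqP El; case/eqP: lp; apply: val_inj.
    by apply: smul_le (smulM (ltp _ ll) (Hd (p + q - l)%N)); apply: degF.
  apply: smul_le (_ : smul J I ((j - (p + q - l)) + (i - l)) _).
    by rewrite [leqRHS]addnC; apply: degF.
  rewrite mulrC; apply: smulM (Hc l); apply: ltq.
  by rewrite ltn_subLR // ltn_add2r.
by move/(domI primeJ IJ JQ (Hc p) (Hd q)); case.
Qed.

End Step.

(** The graded ring of the zero ideal is A in degree 0, where the claim is that J is prime. In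
    positive degree [spow] and [smul] are both the set of elements killed by some s outside Q. *)
Lemma gr_domain0 : gr_domain [set 0].
Proof.
move=> J primeJ J0 JQ i j a b; have [idJ _ JM] := primeJ.
have pow0 n c : spow [set 0] n.+1 c -> smul J [set 0] n.+1 c.
  move=> [s Qs Hc]; exists s => //.
  suff -> : s * c = 0 by apply: ideal0; apply: ideal_mul_ideal.
  apply: (@ideal_mul_min _ _ _ [set 0]) Hc => [|u v -> _]; last by rewrite /= mul0r.
  by split=> // [u v -> ->|u v ->] /=; rewrite ?addr0 ?mulr0.
case: i => [|i] Fa; last by left; apply: pow0.
case: j => [|j] Fb; last by right; apply: pow0.
move=> [s Qs Hs].
have : J (s * (a * b)) by move: Hs; apply: ideal_mul_min => // c d Jc _; apply: ideal_mulr.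
have smul0 c : J c -> smul J [set 0] 0 c.
  by move=> Jc; apply: sub_sat; rewrite -[c]mulr1; apply: ideal_mulM.
by move=> /JM[/JQ//|/JM[/smul0|/smul0]]; [left|right].
Qed.

(* Localised at Q, the primes in this chain are generated by the initial      *)
(* segments of a sequence.                                                    *)
Inductive regular_flag : set A -> Prop :=
| regular_flag0 : prime_ideal [set 0 : A] -> regular_flag [set 0]
| regular_flagS I I' x : regular_flag I -> prime_ideal I' ->
    I `<=` I' -> I' `<=` Q -> I' x -> ~ I x ->
    (forall a, I' a -> exists s y, ~ Q s /\ I (s * a - y * x)) ->
    regular_flag I'.

Lemma regular_flag_domain I : regular_flag I -> prime_ideal I /\ gr_domain I.
Proof.
elim=> [p0|{}I I' x _ [pI dI] pI' II' I'Q I'x Ix gen]; split=> //.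
  exact: gr_domain0.
exact: (gr_domain_step pI II' I'Q I'x Ix gen dI).
Qed.

(** Take I = J = Q: the class of u in degree 0 is nonzero and that of u a^N in degree jN is zero, so
    without zero divisors the class of a in degree j vanishes. *)
Lemma regular_flag_reduced : regular_flag Q -> forall j N u a, ~ Q u ->
  ideal_pow Q j a -> ideal_pow Q (j * N).+1 (u * a ^+ N) ->
  exists2 s, ~ Q s & ideal_pow Q j.+1 (s * a).
Proof.
move=> /regular_flag_domain[_ dQ] j N u a Qu Qa.
have spowX n : spow Q (j * n) (a ^+ n) by apply: sub_sat; apply: ideal_powX.
have nG0 v : ~ Q v -> ~ smul Q Q 0 v.
  move=> Qv [s Qs Hs]; apply: (notQM Qs Qv).
  by move: Hs; apply: ideal_mul_min => // c d Qc _; apply: ideal_mulr.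
have QQ : Q `<=` Q by [].
move=> Hu; have : smul Q Q (j * N) (a ^+ N).
  have [/nG0//|//] := dQ Q primeQ QQ QQ 0%N _ u _ (spow0 Q u) (spowX N) (sub_sat Hu).
elim: {Hu} N => [|N IH]; first by rewrite muln0 => /nG0.
rewrite mulnS exprS => /(dQ Q primeQ QQ QQ _ _ _ _ (sub_sat Qa) (spowX N)).
by case=> // [[s]|/IH//]; exists s.
Qed.

End RegularFlag.

(** * Flags of primes in polynomial rings over a field *)

Section PolynomialFlag.
Variable A : comNzRingType.
Implicit Types (I : set A) (Q : set {poly A}).

Definition polyext I : set {poly A} := [set f | forall i, I f`_i].

Lemma polyext_ideal I : is_ideal I -> is_ideal (polyext I).
Proof.
move=> iI; split=> [i|f g If Ig i|f g Ig i].
- by rewrite coef0; apply: ideal0.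
- by rewrite coefD; apply: idealD.
- by rewrite coefM; apply: ideal_sum => // j _; apply: idealM.
Qed.

Lemma polyextC I a : is_ideal I -> polyext I a%:P <-> I a.
Proof.
move=> iI; split=> [/(_ 0%N)|Ia i]; rewrite coefC ?eqxx //.
by case: eqP => // _; apply: ideal0.
Qed.

(** The product of the lowest coefficients of f and g outside I is, modulo I, a coefficient of f
    g. *)
Lemma polyext_prime I : prime_ideal I -> prime_ideal (polyext I).
Proof.
move=> primeI; have [iI I1 IM] := primeI; split; first exact: polyext_ideal.
  by rewrite -polyC1 => /(polyextC _ iI).
move=> f g; have [|nf] := pselect (polyext I f); first by left.
have [|ng] := pselect (polyext I g) => Hfg; first by right.
have exN h : ~ polyext I h -> exists m, `[< ~ I h`_m >].
  by move=> /existsNP[m Hm]; exists m; apply/asboolP.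
have [p /asboolP Hp minp] := ex_minnP (exN _ nf).
have [q /asboolP Hq minq] := ex_minnP (exN _ ng).
exfalso; apply: (prime_idealM primeI Hp Hq).
have lpq : (p < (p + q).+1)%N by rewrite ltnS leq_addr.
have := Hfg (p + q)%N; rewrite coefM (bigD1 (Ordinal lpq)) //= addKn => Hs.
rewrite -[_ * _](addrK (\sum_(l < (p + q).+1 | l != Ordinal lpq) f`_l * g`_(p + q - l))).
apply: (idealB iI Hs); apply: ideal_sum => // l lp.
have lpq' : (l <= p + q)%N by rewrite -ltnS.
case: (ltngtP l p) => [ll|gl|El]; last by case/eqP: lp; apply: val_inj.
  apply: ideal_mulr => //; apply: contrapT => /asboolP/minp.
  by rewrite leqNgt ll.
apply: idealM => //; apply: contrapT => /asboolP/minq.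
by rewrite leqNgt ltn_subLR // ltn_add2r gl.
Qed.

Definition contr Q : set A := [set a | Q a%:P].

Lemma contr_prime Q : prime_ideal Q -> prime_ideal (contr Q).
Proof.
move=> [[Q0 QD QM] Q1 Qp]; split; first split.
- by rewrite /contr /= polyC0.
- by move=> a b Qa Qb; rewrite /contr /= polyCD; apply: QD.
- by move=> a b Qb; rewrite /contr /= polyCM; apply: QM.
- by rewrite /contr /= polyC1.
- by move=> a b; rewrite /contr /= polyCM; apply: Qp.
Qed.

Lemma polyext_sub I Q : is_ideal Q -> I `<=` contr Q -> polyext I `<=` Q.
Proof.
move=> iQ IQ f If; rewrite -(coefK f) poly_def; apply: ideal_sum => // i _.
by rewrite -mul_polyC mulrC; apply: idealM => //; apply: IQ.
Qed.

(** The generators over A still serve over A[X]; the denominators needed for the coefficients of a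
    polynomial are multiplied together by induction. *)
Lemma regular_flag_polyext I Q : prime_ideal Q ->
  regular_flag (contr Q) I -> regular_flag Q (polyext I).
Proof.
move=> primeQ; have [iQ Q1 _] := primeQ; have primeQ' := contr_prime primeQ.
elim=> [p0|{}I I' x flagI IH primeI' II' I'Q I'x Ix gen].
  have E : polyext [set 0] = [set 0].
    apply/seteqP; split=> [f Hf|_ -> i]; last by rewrite coef0.
    by apply/polyP => i; rewrite coef0; apply: Hf.
  by rewrite E; apply: regular_flag0; rewrite -E; apply: polyext_prime.
have [[iI _ _] _] := regular_flag_domain primeQ' flagI.
have [iI' _ _] := primeI'.
apply: (@regular_flagS _ _ (polyext I) _ x%:P) => //.
- exact: polyext_prime.
- by move=> f Hf i; apply: II'.
- exact: polyext_sub.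
- exact/polyextC.
- by move=> /(polyextC _ iI).
have iPI := polyext_ideal iI.
elim/poly_ind => [_|f c IHf Hf].
  by exists 1, 0; rewrite mulr0 mul0r subr0; split=> //; apply: ideal0.
have /IHf[s [y [Qs Hs]]] : polyext I' f.
  by move=> i; have := Hf i.+1; rewrite coefD coefMX coefC addr0.
have /gen[t [z [Qt Ht]]] : I' c.
  by have := Hf 0%N; rewrite coefD coefMX coefC add0r.
exists (s * t%:P), (t%:P * y * 'X + s * z%:P); split; first exact: prime_idealM.
have -> : s * t%:P * (f * 'X + c%:P) - (t%:P * y * 'X + s * z%:P) * x%:P =
    (t%:P * 'X) * (s * f - y * x%:P) + s * (t * c - z * x)%:P.
  rewrite polyCB !polyCM !(mulrBr, mulrDr, mulrBl, mulrDl) opprD addrACA.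
  congr (_ - _ + (_ - _)).
  - by rewrite [s * _]mulrC [f * _]mulrC mulrACA.
  - by rewrite -!mulrA; congr (_ * _); rewrite mulrCA.
  - by rewrite mulrA.
  - by rewrite mulrA.
by apply: (idealD iPI); apply: (idealM _ iPI) => //; apply/polyextC.
Qed.

(* Over Frac(A/Q'), with Q' the contraction of Q, the ideal Q is principal: a *)
(* generator f of Q modulo Q' extends the flag of Q'.                         *)
Lemma poly_regular_flag :
  (forall P : set A, prime_ideal P -> regular_flag P P) ->
  forall Q, prime_ideal Q -> regular_flag Q Q.
Proof.
move=> flagA Q primeQ; have [iQ Q1 _] := primeQ.
have primeP := contr_prime primeQ; have [iP P1 _] := primeP.
have PQ : polyext (contr Q) `<=` Q by apply: polyext_sub.
have iPP := polyext_ideal iP.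
have flagP := regular_flag_polyext primeQ (flagA _ primeP).
have [QP|/existsNP[f0 /not_implyP[Qf0 Pf0]]] := pselect (Q `<=` polyext (contr Q)).
  by rewrite {2}(_ : Q = polyext (contr Q)) //; apply/seteqP.
(* With P the contraction of Q, f is chosen of least size in Q outside P A[X]. *)
have : exists m, `[< exists f, [/\ Q f, ~ polyext (contr Q) f & size f = m] >].
  by exists (size f0); apply/asboolP; exists f0.
move=> /ex_minnP[m /asboolP[f [Qf Pf Em]] minm].
have small g : Q g -> (size g < m)%N -> polyext (contr Q) g.
  move=> Qg gm; apply: contrapT => Pg.
  have /minm : `[< exists f, [/\ Q f, ~ polyext (contr Q) f & size f = size g] >].
    by apply/asboolP; exists g.
  by rewrite leqNgt gm.
have f_neq0 : f != 0 by apply/eqP => fz; apply: Pf; rewrite fz; apply: ideal0.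
(* Otherwise f without its leading term is a smaller element of Q, hence in P A[X], and f with
   it. *)
have Plc : ~ contr Q (lead_coef f).
  move=> Plc; apply: Pf; pose h := (lead_coef f)%:P * 'X^((size f).-1).
  have Ph : polyext (contr Q) h by apply: (ideal_mulr _ iPP); apply/(polyextC _ iP).
  rewrite -[f](subrK h); apply: (idealD iPP) => //; apply: small.
    by apply: idealB => //; apply: PQ.
  rewrite -Em -(prednK (_ : 0 < size f)%N) ?lt0n ?size_poly_eq0 // ltnS.
  apply/leq_sizeP => j; rewrite coefB coefCM coefXn leq_eqVlt => /predU1P[<-|lt].
    by rewrite eqxx mulr1 subrr.
  rewrite gtn_eqF // mulr0 subr0; apply/leq_sizeP/leqnn.
  by move: lt; case: (size f).
apply: (regular_flagS flagP primeQ PQ _ Qf Pf) => // a Qa.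
(* Pseudo-division by f: the remainder is in Q and smaller than f, so it lies in P A[X]. *)
pose s := lead_coef f ^+ Pdiv.Ring.rscalp a f.
exists s%:P, (Pdiv.Ring.rdivp a f); split.
  by rewrite /s polyC_exp; apply: prime_idealX.
have E : s%:P * a - Pdiv.Ring.rdivp a f * f = Pdiv.Ring.rmodp a f.
  by rewrite mul_polyC Pdiv.ComRing.rdivp_eq addrC addKr.
rewrite E; apply: small; last by rewrite -Em Pdiv.Ring.ltn_rmodp.
by rewrite -E; apply: idealB => //; apply: idealM.
Qed.

End PolynomialFlag.

(** Iterated univariate rings, so that [poly_regular_flag] applies once per variable. *)
Fixpoint iter_poly (k : comNzRingType) (n : nat) : comNzRingType :=
  if n is m.+1 then {poly iter_poly k m} else k.

Lemma iter_poly_flag (k : fieldType) n (Q : set (iter_poly k n)) :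
  prime_ideal Q -> regular_flag Q Q.
Proof.
elim: n Q => [|n IH] Q; last exact: poly_regular_flag.
move=> primeQ; have [[Q0 _ QM] Q1 _] := primeQ.
have E : Q = [set 0].
  apply/seteqP; split=> [a Qa|_ ->//] /=; apply: contrapT => /eqP a0; apply: Q1.
  by rewrite -(mulVf (a0 : (a : k) != 0)); apply: QM.
by rewrite {2}E; apply: regular_flag0; rewrite -E.
Qed.

(** * Smooth algebras as retracts *)

(** [finite_type_presentation] asks for a nonzero ring; an equality of structures lets B be
    substituted for A in everything stated about A. *)
Lemma comNzRing_of_1neq0 (A : comPzRingType) :
  (1 : A) != 0 -> exists B : comNzRingType, B = A :> comPzRingType.
Proof.
case: A => T c A1.
exists (HB.pack_for comNzRingType T (GRing.ComPzRing.Pack c)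
  (GRing.PzSemiRing_isNonZero.Build (GRing.ComPzRing.Pack c) A1)).
by [].
Qed.

Section IdealQuotient.
Variables (S : comNzRingType) (J : set S).
Hypothesis properJ : is_ideal J /\ ~ J 1.

Definition ideal_pred of is_ideal J /\ ~ J 1 := fun a => `[< J a >].

Fact ideal_pred_closed : idealr_closed (ideal_pred properJ).
Proof.
have [iJ J1] := properJ; split=> [||a u v /asboolP Hu /asboolP Hv].
- by apply/asboolP; apply: ideal0.
- exact/asboolP.
- by apply/asboolP; apply: idealD => //; apply: idealM.
Qed.
HB.instance Definition _ := isIdealr.Build S (ideal_pred properJ) ideal_pred_closed.

Lemma ideal_quotient : exists (C : comNzRingType) (pi : {rmorphism S -> C}),
  (forall c, exists a, pi a = c) /\ forall a, pi a = 0 <-> J a.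
Proof.
pose C := {ideal_quot (ideal_pred properJ : idealr S)}.
exists C, (\pi_C : {rmorphism S -> C}); split=> [c|a].
  by elim/quotW: c => a; exists a.
split=> [/eqP|Ja].
  by rewrite -[X in _ == X](rmorph0 \pi_C) -Quotient.idealrBE subr0 => /asboolP.
apply/eqP; rewrite -[X in _ == X](rmorph0 \pi_C) -Quotient.idealrBE subr0.
exact/asboolP.
Qed.

End IdealQuotient.

Lemma rmorph_factor (S B C : comPzRingType) (q : {rmorphism S -> B})
    (pi : {rmorphism S -> C}) :
  (forall b, exists a, q a = b) -> (forall a, q a = 0 -> pi a = 0) ->
  exists w : {rmorphism B -> C}, forall a, w (q a) = pi a.
Proof.
move=> surj ker; pose r b := sval (cid (surj b)).
have rK b : q (r b) = b := svalP (cid (surj b)).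
have E a : pi (r (q a)) = pi a.
  apply/eqP; rewrite -subr_eq0 -rmorphB; apply/eqP/ker.
  by rewrite rmorphB rK subrr.
have wB : zmod_morphism (pi \o r).
  by move=> b c /=; rewrite -[RHS]rmorphB -[RHS]E rmorphB !rK.
have wM : monoid_morphism (pi \o r).
  split=> [|b c] /=; first by rewrite -[in LHS](rmorph1 q) E rmorph1.
  by rewrite -[RHS]rmorphM -[RHS]E rmorphM !rK.
exists (HB.pack_for {rmorphism B -> C} (pi \o r)
  (GRing.isZmodMorphism.Build B C (pi \o r) wB)
  (GRing.isMonoidMorphism.Build B C (pi \o r) wM)).
exact: E.
Qed.

Lemma iter_poly_map (k : fieldType) (B : comNzRingType) (i : {rmorphism k -> B})
    (g : nat -> B) n :
  exists (iota : {rmorphism k -> iter_poly k n})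
         (q : {rmorphism iter_poly k n -> B}),
    (forall c, q (iota c) = i c) /\ forall j, (j < n)%N -> exists a, q a = g j.
Proof.
elim: n => [|n [iota [q [qi qg]]]]; first by exists idfun, i.
have cqg : commr_rmorph q (g n) by move=> a; apply: mulrC.
exists (polyC \o iota : {rmorphism k -> {poly iter_poly k n}}), (horner_morph cqg).
split=> [c|j] /=; first by rewrite horner_morphC qi.
rewrite ltnS leq_eqVlt => /predU1P[->|/qg[a <-]].
  by exists 'X; rewrite horner_morphX.
by exists a%:P; rewrite horner_morphC.
Qed.

Lemma finite_type_presentation (k : fieldType) (B : comNzRingType)
    (i : {rmorphism k -> B}) : finite_type_alg i ->
  exists n (iota : {rmorphism k -> iter_poly k n})
           (q : {rmorphism iter_poly k n -> B}),
    (forall c, q (iota c) = i c) /\ forall b, exists a, q a = b.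
Proof.
move=> [n [g gen]]; pose g' j := if insub j is Some l then g l else 0.
have [iota [q [qi qg]]] := iter_poly_map i g' n.
exists n, iota, q; split=> // b; move: b; apply: gen.
- by move=> c; exists (iota c).
- by move=> j; have [a Ha] := qg j (ltn_ord j); exists a; rewrite Ha /g' valK.
- by move=> _ _ [a <-] [b <-]; exists (a + b); rewrite rmorphD.
- by move=> _ _ [a <-] [b <-]; exists (a * b); rewrite rmorphM.
Qed.

Section Retract.
Variables (k : fieldType) (B : comPzRingType) (i : {rmorphism k -> B}).
Variables (S : comNzRingType) (iota : {rmorphism k -> S}) (q : {rmorphism S -> B}).
Hypotheses (smooth_i : formally_smooth_alg i) (B1 : (1 : B) != 0).
Hypotheses (q_surj : forall b, exists a, q a = b) (qiota : forall c, q (iota c) = i c).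

Let J : set S := [set a | q a = 0].

Let idJ : is_ideal J.
Proof.
split=> [|a b|a b]; rewrite /J /=; first exact: rmorph0.
  by rewrite rmorphD => -> ->; rewrite addr0.
by rewrite rmorphM => ->; rewrite mulr0.
Qed.

Let quotJ n : exists (C : comNzRingType) (pi : {rmorphism S -> C}),
  (forall c, exists a, pi a = c) /\ forall a, pi a = 0 <-> ideal_pow J n.+1 a.
Proof.
apply: ideal_quotient; split; first exact: ideal_pow_ideal.
move=> /(@ideal_pow_le _ _ 1 n.+1 isT); rewrite (ideal_pow1 idJ) /J /= rmorph1.
exact/eqP.
Qed.

(* Formal smoothness lifts the identity of B = S/J successively along the     *)
(* square-zero extensions S/J^(n+2) -> S/J^(n+1).                             *)
Lemma formally_smooth_retract n :
  exists (C : comNzRingType) (pi : {rmorphism S -> C}) (w : {rmorphism B -> C}),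
  [/\ forall c, exists a, pi a = c, forall a, pi a = 0 <-> ideal_pow J n.+1 a,
      forall b a, w b = pi a -> q a = b & forall c, w (i c) = pi (iota c)].
Proof.
elim: n => [|n [C [pi [w [pi_surj ker_pi wq wi]]]]].
  have [C [pi [pi_surj ker_pi]]] := quotJ 0; rewrite (ideal_pow1 idJ) in ker_pi.
  have [a /ker_pi//|w wq] := @rmorph_factor S B C q pi q_surj.
  exists C, pi, w; split=> // [|b a|c]; first by rewrite (ideal_pow1 idJ).
    have [a' <-] := q_surj b; rewrite wq => /eqP; rewrite -subr_eq0 -rmorphB.
    by move=> /eqP/ker_pi/eqP; rewrite rmorphB subr_eq0 => /eqP.
  by rewrite -qiota wq.
have [C' [pi' [pi'_surj ker_pi']]] := quotJ n.+1.
have [|rho rhoE] := @rmorph_factor S C' C pi' pi pi'_surj.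
  by move=> a /ker_pi' Ha; apply/ker_pi; apply: ideal_pow_le Ha.
have [|||w' [w'r w'i]] := @smooth_i C' C (pi' \o iota) rho w.
- by move=> c; have [a <-] := pi_surj c; exists (pi' a).
(* The kernel has square zero: J^(n+1) J^(n+1) lies in J^(n+2). *)
- move=> c d; have [a <-] := pi'_surj c; have [b <-] := pi'_surj d.
  rewrite !rhoE => /ker_pi Ha /ker_pi Hb; rewrite -rmorphM; apply/ker_pi'.
  by apply: ideal_pow_le (ideal_pow_mul Ha Hb); rewrite addnS ltnS leq_addr.
- by move=> c; rewrite /= rhoE wi.
exists C', pi', w'; split=> // b a Hb; apply: wq.
by rewrite -w'r Hb rhoE.
Qed.

End Retract.

(* The retraction mod a high power of the kernel transports the statement     *)
(* from the polynomial ring to B.                                             *)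
Lemma smooth_alg_reduced (k : fieldType) (B : comPzRingType)
    (i : {rmorphism k -> B}) (P : set B) :
  smooth_alg i -> prime_ideal P -> forall j N u a, ~ P u ->
  ideal_pow P j a -> ideal_pow P (j * N).+1 (u * a ^+ N) ->
  exists2 s, ~ P s & ideal_pow P j.+1 (s * a).
Proof.
move=> [ft fs] primeP j N u a Pu Pa Pua; have [iP P1 PM] := primeP.
have B1 : (1 : B) != 0 by apply/eqP => B10; apply: P1; rewrite B10; apply: ideal0.
have [B' EB] := comNzRing_of_1neq0 B1; subst B.
have [n [iota [q [qi q_surj]]]] := finite_type_presentation ft.
(* The kernel of pi is the power jN + 1 of the kernel of q, so it lies in Q^(jN+1) for Q the
   preimage of P: membership there can be tested in C. *)
have [C [pi [w [pi_surj ker_pi wq _]]]] :=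
  formally_smooth_retract fs B1 q_surj qi (j * N).
pose Q : set (iter_poly k n) := [set a | P (q a)].
have primeQ : prime_ideal Q.
  split; [split|..]; rewrite /Q /=.
  - by rewrite rmorph0; apply: ideal0.
  - by move=> b c; rewrite rmorphD; apply: idealD.
  - by move=> b c; rewrite rmorphM; apply: idealM.
  - by rewrite rmorph1.
  - by move=> b c; rewrite rmorphM; apply: PM.
(* By [wq], q sends any lift of w b back to b, so lifts of elements of P lie in Q. *)
have lift m c : ideal_pow P m c -> exists2 e, ideal_pow Q m e & w c = pi e.
  elim: m c => [|m IH] c; first by move=> _; have [e <-] := pi_surj (w c); exists e.
  apply: (@ideal_mul_min _ _ _ [set c | exists2 e, ideal_pow Q m.+1 e & w c = pi e]).
    have iQ := ideal_pow_ideal Q m.+1; split=> [|b d [e He Eb] [f Hf Ed]|b d [e He Ed]] /=.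
    - by exists 0; [exact: ideal0 iQ|rewrite !rmorph0].
    - by exists (e + f); [exact: (idealD iQ He Hf)|rewrite !rmorphD Eb Ed].
    - have [f Ef] := pi_surj (w b).
      by exists (f * e); [exact: (idealM _ iQ He)|rewrite !rmorphM Ed Ef].
  move=> b d Pb /IH[e He Ed] /=; have [f Ef] := pi_surj (w b).
  exists (f * e); last by rewrite !rmorphM Ed Ef.
  by apply: ideal_mulM => //; rewrite /Q /= (wq b f).
have push m e : ideal_pow Q m e -> ideal_pow P m (q e).
  elim: m e => [//|m IH] e.
  apply: (@ideal_mul_min _ _ _ [set e | ideal_pow P m.+1 (q e)]).
    have iPm := ideal_pow_ideal P m.+1; split=> [|b d|b d] /=.
    - by rewrite rmorph0; apply: (ideal0 iPm).
    - by rewrite rmorphD; apply: (idealD iPm).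
    - by rewrite rmorphM; apply: (idealM _ iPm).
  by move=> b d Qb /IH Pd /=; rewrite rmorphM; apply: ideal_mulM.
have [b Qb Eb] := lift _ _ Pa; have [e Qe Ee] := lift _ _ Pua.
have [v Ev] := pi_surj (w u).
have Qvb : ideal_pow Q (j * N).+1 (v * b ^+ N).
  rewrite -[v * _](subrK e); apply: (idealD (ideal_pow_ideal Q _)) => //.
  apply: (@ideal_powS _ [set a | q a = 0]).
    by move=> f /= qf; rewrite /Q /= qf; apply: (ideal0 iP).
  apply/ker_pi; rewrite rmorphB rmorphM rmorphXn -Ee Ev -Eb.
  by rewrite rmorphM rmorphXn subrr.
have Qv : ~ Q v by rewrite /Q /= (wq u v).
have [s Qs Qsb] := regular_flag_reduced primeQ (iter_poly_flag primeQ) Qv Qb Qvb.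
exists (q s) => //; rewrite -(wq a b) // -rmorphM; exact: push.
Qed.

(** * Stalks and integral equivalence *)

(** No homogeneous nilpotents in gr_m(R): the class of a in degree j has N-th power zero exactly
    when a^N lies in m^(jN+1). *)
Definition gr_reduced (R : localRing) := forall j N (a : R),
  ideal_pow (@maxid R) j a -> ideal_pow (@maxid R) (j * N).+1 (a ^+ N) ->
  ideal_pow (@maxid R) j.+1 a.

Lemma maxid_prime (R : localRing) : prime_ideal (@maxid R).
Proof.
split; [exact: maxid_ideal|exact: maxid1|move=> a b nab].
apply: contrapT => /not_orP[/contrapT[c Hc] /contrapT[d Hd]]; apply: nab.
by exists (c * d); rewrite mulrACA Hc Hd mulr1.
Qed.

(** * From a chart to the local ring *)

Section LocalRing.
Variables (R : localRing) (B : comPzRingType) (g : {rmorphism B -> R}).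
Let P : set B := [set b | maxid (g b)].
Hypothesis g_frac : forall z, exists f a, ~ P f /\ z * g f = g a.
Hypothesis g_ker : forall a, g a = 0 -> exists f, ~ P f /\ f * a = 0.

Lemma contr_maxid_prime : prime_ideal P.
Proof.
have [[m0 mD mM] m1 mp] := maxid_prime R.
split; [split|..]; rewrite /P /=.
- by rewrite rmorph0.
- by move=> a b; rewrite rmorphD; apply: mD.
- by move=> a b; rewrite rmorphM; apply: mM.
- by rewrite rmorph1.
- by move=> a b; rewrite rmorphM; apply: mp.
Qed.

(** Elements outside P become units in R by definition of P, so [g_frac] and [g_ker] make R the
    localization of B at P, and m^n is the extension of P^n. *)
Lemma maxid_pow_frac n z : ideal_pow (@maxid R) n z ->
  exists f a, [/\ ~ P f, ideal_pow P n a & z * g f = g a].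
Proof.
have primeP := contr_maxid_prime; have [_ P1 _] := primeP.
elim: n z => [|n IH] z.
  by move=> _; have [f [a [Pf E]]] := g_frac z; exists f, a.
pose T := [set z | exists f a, [/\ ~ P f, ideal_pow P n.+1 a & z * g f = g a]].
apply: (@ideal_mul_min _ _ _ T) => [|y {}z my /IH[f [a [Pf Ha E]]]].
  have iPn := ideal_pow_ideal P n.+1.
  split=> [|y {}z [f [a [Pf Ha E]]] [h [b [Ph Hb E']]]|y {}z [f [a [Pf Ha E]]]].
  - by exists 1, 0; split; [|exact: (ideal0 iPn)|rewrite mul0r rmorph0].
  - exists (f * h), (h * a + f * b); split; first exact: prime_idealM.
      by apply: (idealD iPn); apply: (idealM _ iPn).
    by rewrite rmorphD !rmorphM -E -E' mulrDl mulrA [g h * _]mulrC [g f * (z * _)]mulrCA.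
  - have [h [b [Ph E']]] := g_frac y.
    exists (h * f), (b * a); split; [exact: prime_idealM|exact: (idealM _ iPn)|].
    by rewrite !rmorphM -E -E' mulrACA.
have [h [b [Ph E']]] := g_frac y.
exists (h * f), (b * a); split; first exact: prime_idealM.
  apply: ideal_mulM => //; rewrite /P /= -E'.
  exact: (ideal_mulr _ (@maxid_ideal R)).
by rewrite !rmorphM -E -E' mulrACA.
Qed.

Lemma maxid_pow_cancel n f z : ~ P f ->
  ideal_pow (@maxid R) n (g f * z) -> ideal_pow (@maxid R) n z.
Proof.
move=> /contrapT[h Hh] Hz; have -> : z = h * (g f * z).
  by rewrite mulrA [h * _]mulrC Hh mul1r.
exact: (idealM _ (ideal_pow_ideal _ _)).
Qed.

(** After clearing denominators, the relation on the N-th power holds in B only up to a factor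
    outside P; this is why the hypothesis on B carries u. *)
Lemma localization_gr_reduced :
  (forall j N u a, ~ P u -> ideal_pow P j a ->
     ideal_pow P (j * N).+1 (u * a ^+ N) ->
     exists2 s, ~ P s & ideal_pow P j.+1 (s * a)) ->
  gr_reduced R.
Proof.
move=> redP j N z mz mzN; have primeP := contr_maxid_prime.
have [f [a [Pf Ha E]]] := maxid_pow_frac mz.
have [h [c [Ph Hc EN]]] := maxid_pow_frac mzN.
have [|t [Pt Et]] := @g_ker (h * a ^+ N - f ^+ N * c).
  rewrite rmorphB !rmorphM !rmorphXn -E -EN exprMn mulrCA.
  by rewrite [z ^+ N * _]mulrC mulrA [g h * _]mulrC -!mulrA [g h * _]mulrC subrr.
have [||s Ps Hs] := redP j N (t * h) a _ Ha.
- exact: prime_idealM.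
- move/eqP: Et; rewrite mulrBr subr_eq0 mulrA => /eqP ->.
  by rewrite mulrA; apply: (idealM _ (ideal_pow_ideal _ _)).
apply: (maxid_pow_cancel Pf); apply: (maxid_pow_cancel Ps).
rewrite [g f * z]mulrC E -rmorphM.
move: (s * a) Hs => b; elim: (j.+1) b => [//|n IH] b.
apply: (@ideal_mul_min _ _ _ [set b | ideal_pow (@maxid R) n.+1 (g b)]).
  have im := ideal_pow_ideal (@maxid R) n.+1; split=> [|u v|u v] /=.
  - by rewrite rmorph0; apply: (ideal0 im).
  - by rewrite rmorphD; apply: (idealD im).
  - by rewrite rmorphM; apply: (idealM _ im).
by move=> u v Pu /IH Hv /=; rewrite rmorphM; apply: ideal_mulM.
Qed.

End LocalRing.

(** [stalk_chart] presents the stalk as a localization of the abstract chart ring A; smoothness is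
    stated for O(U), so the same is needed there. *)
Lemma affine_germ (V : scheme) (x : V) (U : opens V) (hU : oset U x) :
  affine_open U ->
  (forall z : stalk x, exists f a,
     ~ is_nonunit (germ hU f) /\ z * germ hU f = germ hU a) /\
  (forall a, germ hU a = 0 -> exists f, ~ is_nonunit (germ hU f) /\ f * a = 0).
Proof.
move=> [A [alpha [phi [phiP _ _ zar loc]]]].
have Dop f : open [set y | oset U y /\ ~ phi y f].
  apply/zar; first by move=> y [].
  by move=> y [Uy Hy]; exists f.
pose D f := Opens (Dop f).
have hD f : D f `<=` U by move=> y [].
have locD f := loc f (D f) (hD f) (fun y => iff_refl _).
have Px := phiP _ hU.
have small W : open W -> W x -> exists2 f, ~ phi x f & D f `<=` W.
  move=> oW Wx; have : open (W `&` oset U) by apply: openI => //; exact: oset_open.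
  move=> /(zar _ (@subIsetr _ _ _))/(_ x (conj Wx hU))[f Hf fW].
  by exists f => // y [Uy Hy]; case: (fW y Uy Hy).
have unit f n : ~ phi x f -> ~ is_nonunit (germ hU (alpha (f ^+ n))).
  move=> /(@prime_idealX _ _ _ n Px) Hf; apply; have [[g Hg] _ _] := locD (f ^+ n).
  have Dx : oset (D (f ^+ n)) x by [].
  exists (germ Dx g).
  by rewrite -(germ_res hU _ Dx (hD (f ^+ n))) -rmorphM Hg rmorph1.
(* D(1) is all of U, so A -> O(U) is the localization at 1. *)
have alpha_surj b : exists a, b = alpha a.
  have UU : U `<=` U by [].
  have [|_ /(_ b)[n [a Ha]] _] := loc 1 U UU.
    by move=> y; split=> [Uy|[]//]; split=> //; case: (phiP _ Uy).
  by exists a; move: Ha; rewrite !res_id rmorph1 expr1n mulr1.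
split=> [z|b].
  have [W [hW [s ->]]] := germP z.
  have [f Hf fW] := small _ (oset_open W) hW.
  have Dx : oset (D f) x by [].
  have [_ /(_ (res fW s))[n [a Ha]] _] := locD f.
  exists (alpha (f ^+ n)), (alpha a); split; first exact: unit.
  rewrite -(germ_res hW _ Dx fW) -(germ_res hU _ Dx (hD f)) -rmorphM !rmorphXn.
  by rewrite Ha; exact: germ_res.
have [a ->] := alpha_surj b; move=> /eqP; rewrite -(rmorph0 (germ hU)) => /eqP.
move=> /germ_eq[Z [h [h' [Zx e]]]].
have [f Hf fZ] := small _ (oset_open Z) Zx.
have [_ _ /(_ a)[|n Hn]] := locD f.
  by rewrite -(res_comp h fZ) e rmorph0 rmorph0.
exists (alpha (f ^+ n)); split; first exact: unit.
by rewrite -rmorphM Hn rmorph0.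
Qed.

Lemma smooth_gr_reduced (k : fieldType) (V : scheme)
    (str : {rmorphism k -> sec V (topen V)}) (x : V) :
  smooth str -> gr_reduced (local_stalk x).
Proof.
move=> /(_ x)[U [hU affU smU]]; have [frac ker] := affine_germ hU affU.
pose g : {rmorphism sec V U -> local_stalk x} := germ hU.
apply: (@localization_gr_reduced _ _ g) => //.
apply: (smooth_alg_reduced smU); exact: contr_maxid_prime.
Qed.

(** Take the coefficient of W^(nN) in the monic equation of degree N: its term of index i
    contributes c_i a^i, with c_i the degree n(N-i) part of the i-th coefficient. *)
Lemma integral_monomial (R : comNzRingType) (I : nat -> set R) n (a : R) :
  integral_over [set F : {poly R} | forall n, I n F`_n] (a *: 'X^n) ->
  exists N (c : nat -> R), a ^+ N = - \sum_(i < N) c i * a ^+ i /\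
    forall i, (i < N)%N -> I (n * (N - i))%N (c i).
Proof.
move=> [p [/monicP p1 Ip /eqP]]; rewrite horner_coef; pose N := (size p).-1.
have -> : size p = N.+1.
  by rewrite prednK // lt0n size_poly_eq0 -lead_coef_eq0 p1 oner_neq0.
move=> p0; exists N, (fun i => p`_i`_(n * (N - i))); split=> [|i _]; last exact: Ip.
have := congr1 (fun F : {poly R} => F`_(n * N)) p0.
rewrite coef0 coef_sum big_ord_recr /= => E.
apply/eqP; rewrite -addr_eq0 addrC; apply/eqP; rewrite -[RHS]E.
have coefE i : (i <= N)%N ->
    (p`_i * (a *: 'X^n) ^+ i)`_(n * N) = p`_i`_(n * (N - i)) * a ^+ i.
  move=> iN; rewrite exprZn -exprM -scalerAr coefZ coefMXn ltnNge leq_mul //=.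
  by rewrite mulnBr mulrC.
rewrite coefE // subnn muln0 [p`_N]p1 coef1 mul1r; congr (_ + _).
by apply: eq_bigr => i _; rewrite coefE // ltnW.
Qed.

(** A section s of degree n makes s W^n trivially integral over G'; equivalence makes it integral
    over G, and the equation is read off at x. *)
Lemma stalk_component_integral (V : scheme) (G G' : reesAlgebra V) (x : V) n a :
  integrally_equivalent G G' -> stalk_component G' x n a ->
  integral_over (rees_stalk G x) (a *: 'X^n).
Proof.
move=> GG' [U [hU [s [Gs ->]]]]; pose b i : sec V U := if i == n then s else 0.
have Gb i : G' i U (b i).
  rewrite /b; case: eqP => [->//|_].
  by have [iG _ _] := rcomp_graded G' U; apply: ideal0.
have /(GG' U b)[_ /(_ x hU)[d b0]] : int_closure G' b.
  split=> [y Uy|y Uy].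
    exists U, (fun _ h => h), n.+1; split=> // i ni.
    by rewrite /b gtn_eqF // rmorph0.
  exists n.+1 => [i ni|]; first by rewrite /b gtn_eqF // rmorph0.
  set F := \poly_(i < _) _; exists ('X - F%:P); split.
  - exact: monicXsubC.
  - have inG (t : nat -> sec V U) : (forall i, G' i U (t i)) ->
        forall i, stalk_component G' y i (germ Uy (t i)).
      by move=> Gt i; exists U, Uy, (t i).
    have [iG G0 _] := rcomp_graded G' U.
    (* Covers the coefficients 0 and 1 of ['X - F%:P], seen as constant polynomials in W. *)
    have const m i : stalk_component G' y i (m%:R *+ (i == 0%N) : stalk y).
      have := inG (fun i => m%:R *+ (i == 0%N)) _ i.
      rewrite rmorphMn rmorph_nat; apply; case=> [|i']; first by rewrite G0.
      by apply: ideal0.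
    move=> l i; rewrite coefB coefX coefC.
    case: l => [|l] /=.
      rewrite sub0r coefN coef_poly; case: ltnP => ni; last first.
        by have := const 0%N i; rewrite mul0rn oppr0.
      rewrite -rmorphN; apply: (inG (fun i => - b i)) => l.
      by apply: idealN.
    rewrite subr0; case: l => [|l] /=.
      by have := const 1%N i; rewrite coef1 -mulr_natr mul1r; case: (i == 0%N).
    by have := const 0%N i; rewrite coef0 mul0rn.
  - by rewrite root_XsubC.
suff -> : \poly_(i < d) (germ hU (b i) : local_stalk x) = germ hU s *: 'X^n by [].
apply/polyP => i; rewrite coef_poly coefZ coefXn.
have -> : (if (i < d)%N then germ hU (b i) else 0) = germ hU (b i).
  by case: ltnP => // /b0.
by rewrite /b; case: eqP; rewrite ?mulr1 // mulr0 rmorph0.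
Qed.

(** The order of a is raised from j to j + 1 as long as j < n, by applying [gr_reduced] to a^N. *)
Lemma Sing_sub (V : scheme) (G G' : reesAlgebra V) (x : V) :
  gr_reduced (local_stalk x) -> integrally_equivalent G G' ->
  Sing G x -> Sing G' x.
Proof.
move=> red GG' SGx n n0 a /(stalk_component_integral GG')/integral_monomial.
move=> [N [c [E Ic]]].
suff: forall j, (j <= n)%N -> ideal_pow (@maxid (local_stalk x)) j a by apply.
elim=> [//|j IH] jn; have ma := IH (ltnW jn); apply: (red _ N) => //.
have im := ideal_pow_ideal (@maxid (local_stalk x)) (j * N).+1.
rewrite E; apply: (idealN im); apply: ideal_sum => // i _.
have iN := ltn_ord i; have nNi : (0 < n * (N - i))%N by rewrite muln_gt0 n0 subn_gt0.
(* The order of c_i a^i is at least n(N-i) + ji, which exceeds jN because j < n and i < N. *)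
apply: ideal_pow_le (ideal_pow_mul (SGx _ nNi _ (Ic _ iN)) (ideal_powX i ma)).
rewrite -[in leqLHS](subnK (ltnW iN)) mulnDr -addSn leq_add2r.
apply: leq_trans (leq_mul jn (leqnn _)); rewrite mulSn -add1n leq_add2r.
by rewrite subn_gt0.
Qed.

(** In(a)^N is minus the sum of the In(c_i) In(a)^i, and each In(c_i) is in the initial ideal of G
    because N - i > 0. So a prime containing that ideal contains In(a). *)
Lemma cone_sub (V : scheme) (G G' : reesAlgebra V) (x : V) :
  integrally_equivalent G G' -> Sing G x -> Sing G' x ->
  cone (stalk_component G x) `<=` cone (stalk_component G' x).
Proof.
move=> GG' SGx SG'x P [primeP GP]; split=> //; have [iP P1 PM] := primeP.
move=> u; apply=> // _ [n [a [n0 G'a ->]]].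
have ma := SG'x n n0 a G'a.
have [N [c [E Ic]]] := integral_monomial (stalk_component_integral GG' G'a).
(* Membership in m^(nN) is recorded because additivity of [initform] is only available there. *)
pose K : set (local_stalk x) := [set b | ideal_pow (@maxid (local_stalk x)) (n * N) b /\
  P (initform (n * N) b)].
have im := ideal_pow_ideal (@maxid (local_stalk x)) (n * N).
have KN b : K b -> K (- b).
  move=> [mb Pb]; split; first exact: (idealN im).
  rewrite -[- b]mulrN1 -(addn0 (n * N)%N) initformM // mulrC.
  exact: (idealM _ iP).
have initX i : initform (n * i) (a ^+ i) = initform n a ^+ i.
  elim: i => [|i IH].
    by rewrite muln0 !expr0 -gr_constE !rmorph1.
  by rewrite mulnS !exprS -IH initformM //; apply: ideal_powX.
have KaN : K (a ^+ N).
  rewrite E; apply: KN; apply: (big_ind K).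
  - split; first exact: (ideal0 im).
    have -> : initform (n * N) (0 : local_stalk x) = 0; last exact: (ideal0 iP).
    by apply: (addrI (initform (n * N) 0)); rewrite -initformD ?addr0 //; apply: (ideal0 im).
  - move=> b d [mb Pb] [md Pd]; split; first exact: (idealD im).
    by rewrite initformD //; apply: (idealD iP).
  move=> i _; have iN := ltn_ord i.
  have nNi : (0 < n * (N - i))%N by rewrite muln_gt0 n0 subn_gt0.
  have mc := SGx _ nNi _ (Ic _ iN); have mai := ideal_powX i ma.
  have EN : (n * N = n * (N - i) + n * i)%N by rewrite -mulnDr subnK // ltnW.
  split; rewrite EN; first exact: ideal_pow_mul.
  rewrite initformM //; apply: (ideal_mulr _ iP); apply: GP; apply: sub_ideal_gen.
  by exists (n * (N - i))%N, (c i); split=> //; apply: Ic.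
move: KaN => [_]; rewrite initX; elim: (N) => [//|m IH].
by rewrite exprS => /PM[//|/IH].
Qed.

Theorem theorem5p2 (k : fieldType) (V : scheme)
    (str : {rmorphism k -> sec V (topen V)}) (G G' : reesAlgebra V) :
  smooth str ->
  integrally_equivalent G G' ->
  Sing G = Sing G' /\ forall x : V, Sing G x -> tau G x = tau G' x.
Proof.
move=> smV GG'; have G'G : integrally_equivalent G' G by move=> U a; split=> /GG'.
have red x : gr_reduced (local_stalk x) := @smooth_gr_reduced k V str x smV.
have ES : Sing G = Sing G' by apply/seteqP; split=> x; apply: Sing_sub.
split=> // x SGx; have SG'x : Sing G' x by rewrite -ES.
have EC : cone (stalk_component G x) = cone (stalk_component G' x).
  by apply/seteqP; split; apply: cone_sub.
(* Once unfolded, [tau] mentions the stalk components only inside [cone]. *)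
by rewrite /tau /vertex_space /stable_subspace /translation_stable EC.
Qed.
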